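(* (i) $\mathsf{ZPP}\subseteq\mathsf{YP}$. (ii) $\mathsf{YE}=\mathsf{NE}\cap\mathsf{coNE}$. (iii) If $\mathsf{P}=\mathsf{YP}$ then $\mathsf{E}=\mathsf{NE}\cap\mathsf{coNE}$. (iv) If $\mathsf{E}=\mathsf{NE}^{\mathsf{NP}^{\mathsf{NP}}}$ then $\mathsf{P}=\mathsf{YP}$.
   Context: $\mathsf{YP}$ (''untrusted advice'') is the class of languages $L$ for which there exist a polynomial $p$ and a deterministic polynomial-time algorithm $A$ such that for every $n$: (a) there exists $y_n\in\{0,1\}^{p(n)}$ such that $A(x,y_n)$ outputs $L(x)$ for all $x\in\{0,1\}^n$; and (b) for all $x\in\{0,1\}^n$ and all strings $y$, $A(x,y)$ outputs either $L(x)$ or ''don't know''. $\mathsf{YE}$ is the exponential-time analogue: the same definition with the advice length and the running time of $A$ both $2^{O(n)}$. $\mathsf{E}$ and $\mathsf{NE}$ denote deterministic and nondeterministic time $2^{O(n)}$. *)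

(* Defs.v *)
From mathcomp Require Import all_boot.
Set Implicit Arguments. Unset Strict Implicit. Unset Printing Implicit Defensive.

Definition lang := seq bool -> bool.

Inductive sym := Blank | Bit of bool | Sep.
Inductive move := MoveL | MoveR | Stay.

(* One-way infinite tape: [tl] = cells left of the head (reversed),
   [tr] = head cell and cells to its right (blanks beyond). *)
Record tape := Tape { tl : seq sym; tr : seq sym }.

Definition head_sym (t : tape) : sym :=
  if tr t is a :: _ then a else Blank.
Definition write_sym (t : tape) (a : sym) : tape :=
  Tape (tl t) (a :: behead (tr t)).
Definition move_tape (m : move) (t : tape) : tape :=
  match m with
  | MoveL => if tl t is a :: l then Tape l (a :: tr t) else t
  | MoveR => if tr t is a :: r then Tape (a :: tl t) r else Tape (Blank :: tl t) [::]
  | Stay => t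
  end.

Fixpoint bits_prefix (s : seq sym) : seq bool :=
  if s is Bit b :: s' then b :: bits_prefix s' else [::].
Definition query_string (t : tape) : seq bool := bits_prefix (rev (tl t) ++ tr t).

(* Actions: halt with an output (Some b = answer b, None = "don't know"),
   an ordinary step on both tapes, or an oracle query (go to the first state
   if the query string is in the oracle, to the second otherwise). *)
Inductive action (Q : Type) :=
  | Halt of option bool
  | Step of Q & sym & move & sym & move
  | Query of Q & Q.
Arguments Halt {Q}.

(* A machine: finite state set, start state, transition function reading the
   two head symbols and the current choice (nondeterministic/random) bit. *)
Record TM := { state : finType; start : state;
               delta : state -> sym -> sym -> bool -> action state }.

Definition oracle := seq bool -> bool.

Fixpoint run (M : TM) (O : oracle) (c : nat -> bool) (fuel i : nat)
  (q : state M) (t1 t2 : tape) : option (option bool) :=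
  match fuel with
  | 0 => None
  | fuel'.+1 =>
    match delta q (head_sym t1) (head_sym t2) (c i) with
    | Halt o => Some o
    | Step q' a1 m1 a2 m2 =>
        run O c fuel' i.+1 q' (move_tape m1 (write_sym t1 a1)) (move_tape m2 (write_sym t2 a2))
    | Query qy qn => run O c fuel' i.+1 (if O (query_string t2) then qy else qn) t1 t2
    end
  end.

Definition result (M : TM) (O : oracle) (c : nat -> bool) (w : seq sym) (T : nat) :=
  run O c T 0 (start M) (Tape [::] w) (Tape [::] [::]).

Definition enc (x : seq bool) : seq sym := map Bit x.
Definition encp (x y : seq bool) : seq sym := map Bit x ++ Sep :: map Bit y.

Definition no_oracle : oracle := fun _ => false.
Definition det_choices : nat -> bool := fun _ => false.

Definition polyb (k n : nat) := n ^ k + k.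
Definition expb (k n : nat) := 2 ^ (k * n + k).
Definition peval (p : seq nat) (n : nat) := \sum_(i < size p) nth 0 p i * n ^ i.

Definition DTIME_O (O : oracle) (T : nat -> nat) (L : lang) : Prop :=
  exists M : TM, forall x, result M O det_choices (enc x) (T (size x)) = Some (Some (L x)).

Definition NTIME_O (O : oracle) (T : nat -> nat) (L : lang) : Prop :=
  exists M : TM, forall x,
    (forall c, exists o, result M O c (enc x) (T (size x)) = Some o) /\
    (L x <-> exists c, result M O c (enc x) (T (size x)) = Some (Some true)).

Definition P (L : lang) := exists k, DTIME_O no_oracle (polyb k) L.
Definition E (L : lang) := exists k, DTIME_O no_oracle (expb k) L.
Definition NP_O (O : oracle) (L : lang) := exists k, NTIME_O O (polyb k) L.
Definition NE_O (O : oracle) (L : lang) := exists k, NTIME_O O (expb k) L.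
Definition NP := NP_O no_oracle.
Definition NE := NE_O no_oracle.
Definition coNE (L : lang) := NE (fun x => ~~ L x).
Definition NP_NP (L : lang) := exists A : lang, NP A /\ NP_O A L.
Definition NE_NP_NP (L : lang) := exists A : lang, NP_NP A /\ NE_O A L.

Definition stream (T : nat) (r : {ffun 'I_T -> bool}) : nat -> bool :=
  fun i => if (insub i : option 'I_T) is Some j then r j else false.

Definition ZPP (L : lang) : Prop :=
  exists k (M : TM), forall x,
    let T := polyb k (size x) in
    (forall c, result M no_oracle c (enc x) T = Some (Some (L x)) \/
               result M no_oracle c (enc x) T = Some None) /\
    2 * #|[set r : {ffun 'I_T -> bool} |
             result M no_oracle (stream r) (enc x) T == Some None]| <= 2 ^ T.

Definition YP (L : lang) : Prop :=
  exists (p : seq nat) (k : nat) (M : TM),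
    (forall n, exists y, size y = peval p n /\
       forall x, size x = n ->
         result M no_oracle det_choices (encp x y) (polyb k n) = Some (Some (L x))) /\
    (forall x y,
       result M no_oracle det_choices (encp x y) (polyb k (size x)) = Some (Some (L x)) \/
       result M no_oracle det_choices (encp x y) (polyb k (size x)) = Some None).

Definition YE (L : lang) : Prop :=
  exists (a : nat -> nat) (k : nat) (M : TM),
    (forall n, a n <= expb k n) /\
    (forall n, exists y, size y = a n /\
       forall x, size x = n ->
         result M no_oracle det_choices (encp x y) (expb k n) = Some (Some (L x))) /\
    (forall x y,
       result M no_oracle det_choices (encp x y) (expb k (size x)) = Some (Some (L x)) \/
       result M no_oracle det_choices (encp x y) (expb k (size x)) = Some None).

(* Main.v *)
(* Programs for machines with a read-only input stream and a bounded number of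
   stacks of bits are compiled to the two-tape machines of the definitions with
   quadratic overhead: the stacks lie side by side on the second tape, and a push
   or a pop shifts part of that tape.

   ZPP <= YP: by averaging, some random string settles at least half of the inputs
   of size n that are still open, so n + 1 strings settle all of them; they form
   the advice.

   YE = NE /\ coNE: the advice lists, for every input of size n, an accepting run
   of the machine for L or of the one for its complement. Conversely one guesses
   the advice; an answer other than "don't know" is right for any guess.

   P = YP -> E = NE /\ coNE: for L in NE /\ coNE the same advice shows that a
   padded version of L is in YP = P, hence L is in E.

   E = NE^(NP^NP) -> P = YP: the prefixes of good advice form a language in NP^NP,
   since "y is bad advice" is in NP. The bits of the lexicographically largest good
   advice, indexed by pairs of binary numbers, are thus computed in E^(NP^NP) by
   prefix search, so by hypothesis in time exponential in the logarithm of n, that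
   is, polynomial in n. *)
From HB Require Import structures.
Require Import Defs.
From mathcomp Require Import all_boot zify.
Set Implicit Arguments. Unset Strict Implicit. Unset Printing Implicit Defensive.

(** Arbitrary advice must be answered within a time that depends on the length of the input alone,
    and the advice may also end too early. So the programs for YP and YE never scan it to its end:
    they compute a block length in unary from the input and read that many cells, a cell without a
    bit counting as [false]. The good advice is padded to the prescribed length. A machine receives
    a choice bit at every step, whether it looks at it or not, while the step at which a program
    needs its next bit is hidden by the compilation. Programs therefore consume a list of bits, and
    only the passage to [TM] converts between lists and streams. In YE the advice length is an
    arbitrary bounded function, perhaps not computable, so the nondeterministic machine guesses a
    string of any length up to the bound. Being bad advice is an NP property because wrong answers
    are excluded: bad means that some input is left undecided, which speaks of runs of [A] and not
    of [L]. The quadratic overhead of the compilation is harmless because polynomial and exponential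
    bounds are closed under squaring. *)

Definition sym_code (a : sym) : option (option bool) :=
  match a with Blank => None | Sep => Some None | Bit b => Some (Some b) end.
Definition sym_decode (o : option (option bool)) : sym :=
  match o with None => Blank | Some None => Sep | Some (Some b) => Bit b end.
Lemma sym_codeK : cancel sym_code sym_decode. Proof. by case. Qed.
HB.instance Definition _ := Countable.copy sym (can_type sym_codeK).
HB.instance Definition _ := isFinite.Build sym
  (pcan_enumP (can_pcan sym_codeK)).

(** * Machine fragments with labelled exits, their sequencing and loops *)

Inductive pact (S : Type) :=
  | PStep of S & sym & move & sym & move
  | PAsk of S & S.

Definition pact_map S S' (h : S -> S') (a : pact S) : pact S' :=
  match a with
  | PStep q a1 m1 a2 m2 => PStep (h q) a1 m1 a2 m2
  | PAsk q q' => PAsk (h q) (h q')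
  end.

(* Control leaves a fragment through a label in [F]; only the states in [pch]
   see the choice bit. *)
Record pM (F : Type) := PM {
  pst : finType; p0 : pst;
  pd : pst -> sym -> sym -> bool -> pact (pst + F);
  pch : pst -> bool }.

Definition tcfg := (tape * tape * seq bool)%type.

Definition pstep (O : oracle) F (m : pM F) (q : pst m) (c : tcfg) : (pst m + F) * tcfg :=
  let: (t1, t2, y) := c in
  let y' := if pch q then behead y else y in
  match pd q (head_sym t1) (head_sym t2) (pch q && head false y) with
  | PStep q' a1 m1 a2 m2 =>
      (q', (move_tape m1 (write_sym t1 a1), move_tape m2 (write_sym t2 a2), y'))
  | PAsk qy qn => (if O (query_string t2) then qy else qn, (t1, t2, y'))
  end.

Inductive reach (O : oracle) F (m : pM F) : nat -> pst m -> tcfg -> F -> tcfg -> Prop :=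
  | reach1 q c f c' : pstep O q c = (inr f, c') -> reach O 1 q c f c'
  | reachS n q c q1 c1 f c' :
      pstep O q c = (inl q1, c1) -> reach O n q1 c1 f c' -> reach O n.+1 q c f c'.

Definition ret F (f : F) : pM F :=
  @PM F unit tt (fun _ a1 a2 _ => PStep (inr f) a1 Stay a2 Stay) (fun _ => false).

Section Bind.
Variables (F : finType) (G : Type) (m : pM F) (N : F -> pM G).
Definition bind_st : finType := (pst m + {f : F & pst (N f)})%type.
Definition bind_l (s : pst m + F) : bind_st + G :=
  match s with
  | inl q => inl (inl q)
  | inr f => inl (inr (Tagged (fun f => pst (N f)) (p0 (N f))))
  end.
Definition bind_r f (s : pst (N f) + G) : bind_st + G :=
  match s with
  | inl q => inl (inr (Tagged (fun f => pst (N f)) q))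
  | inr g => inr g
  end.
Definition bind : pM G :=
  @PM G bind_st (inl (p0 m))
    (fun s a1 a2 c => match s with
       | inl q => pact_map bind_l (pd q a1 a2 c)
       | inr (existT f q) => pact_map (@bind_r f) (pd q a1 a2 c)
       end)
    (fun s => match s with inl q => pch q | inr (existT f q) => pch q end).

Lemma pstep_bindl O q c :
  pstep O (m := bind) (inl q) c = (bind_l (pstep O q c).1, (pstep O q c).2).
Proof.
case: c => [[t1 t2] y]; rewrite /pstep /=.
by case: (pd _ _ _ _) => [s a1 m1 a2 m2|s s'] //=; case: (O _).
Qed.

Lemma pstep_bindr O f (q : pst (N f)) c :
  pstep O (m := bind) (inr (Tagged (fun f => pst (N f)) q)) c
  = (bind_r (pstep O q c).1, (pstep O q c).2).
Proof.
case: c => [[t1 t2] y]; rewrite /pstep /=.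
by case: (pd _ _ _ _) => [s a1 m1 a2 m2|s s'] //=; case: (O _).
Qed.

Lemma reach_bind O n1 n2 q c f c1 g c2 :
  reach O n1 q c f c1 -> reach O n2 (p0 (N f)) c1 g c2 ->
  reach O (m := bind) (n1 + n2) (inl q) c g c2.
Proof.
move=> r1 r2.
have {}r2 : reach O (m := bind) n2 (inr (Tagged (fun f => pst (N f)) (p0 (N f)))) c1 g c2.
  elim: r2 => [s d h d' e|n s d s1 d1 h d' e _ IH].
    by apply: reach1; rewrite pstep_bindr e.
  by apply: reachS IH; rewrite pstep_bindr e.
elim: r1 r2 => [{}q {}c {}f c' e|n {}q {}c q1 {}c1 {}f c' e _ IH] r2.
  by apply: reachS r2; rewrite pstep_bindl e.
by apply: reachS (IH r2); rewrite pstep_bindl e.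
Qed.
End Bind.

Section Loop.
Variables (A : finType) (B : Type) (body : A -> pM (A + B)).
Definition loop_st : finType := {a : A & pst (body a)}.
Definition loop_r a (s : pst (body a) + (A + B)) : loop_st + B :=
  match s with
  | inl q => inl (Tagged (fun a => pst (body a)) q)
  | inr (inl a') => inl (Tagged (fun a => pst (body a)) (p0 (body a')))
  | inr (inr b) => inr b
  end.
Definition loop (a : A) : pM B :=
  @PM B loop_st (Tagged (fun a => pst (body a)) (p0 (body a)))
    (fun s a1 a2 c => let: existT a q := s in pact_map (@loop_r a) (pd q a1 a2 c))
    (fun s => let: existT a q := s in pch q).

Lemma pstep_loop O a0 a (q : pst (body a)) c :
  pstep O (m := loop a0) (Tagged (fun a => pst (body a)) q) c
  = (loop_r (pstep O q c).1, (pstep O q c).2).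
Proof.
case: c => [[t1 t2] y]; rewrite /pstep /=.
by case: (pd _ _ _ _) => [s a1 m1 a2 m2|s s'] //=; case: (O _).
Qed.

Lemma reach_loop_stop O n a c b c' :
  reach O n (p0 (body a)) c (inr b) c' -> reach O (m := loop a) n (p0 (loop a)) c b c'.
Proof.
rewrite /=; move: (p0 (body a)) => q; move e: (inr b) => s r.
elim: r e => [{}q {}c f {}c' e|{}n {}q {}c q1 c1 f {}c' e _ IH] ef.
  by apply: reach1; rewrite pstep_loop e -ef.
by apply: reachS (IH ef); rewrite pstep_loop e.
Qed.

Lemma reach_loop_next O n1 n2 a c a' c1 b c2 :
  reach O n1 (p0 (body a)) c (inl a') c1 ->
  reach O (m := loop a') n2 (p0 (loop a')) c1 b c2 ->
  reach O (m := loop a) (n1 + n2) (p0 (loop a)) c b c2.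
Proof.
move=> r1 r2.
(* [loop a] and [loop a'] differ only in their start state, which the transitions never consult. *)
have {}r2 : reach O (m := loop a) n2 (p0 (loop a')) c1 b c2.
  elim: r2 => [s d h d' e|n s d s1 d1 h d' e _ IH]; first exact: reach1.
  exact: reachS IH.
move: r1 r2; rewrite [p0 (loop a)]/=; move: (p0 (body a)) => q; move e: (inl a') => s r1.
elim: r1 e => [{}q {}c f c' e|n {}q {}c q1 {}c1 f c' e _ IH] ef r2.
  by apply: reachS r2; rewrite pstep_loop e -ef.
by apply: reachS (IH ef r2); rewrite pstep_loop e.
Qed.
End Loop.

(** * The stack layout of the second tape *)

(* [tl] of the second tape while the head rests at the right end: register 0 is
   the rightmost segment, the top of a register is its right end, and the last
   register, read from the left end of the tape, is the query string. *)
Fixpoint flat (rs : seq (seq bool)) : seq sym :=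
  if rs is a :: rest then
    map Bit a ++ (if rest is [::] then [::] else Sep :: flat rest)
  else [::].

Definition is_blank (a : sym) := if a is Blank then true else false.
Definition blank := all is_blank.
Definition solid := all (fun a => ~~ is_blank a).

Fixpoint upd (r : seq (seq bool)) (j : nat) (v : seq bool) :=
  match r, j with
  | [::], _ => [::]
  | _ :: r', 0 => v :: r'
  | x :: r', j'.+1 => x :: upd r' j' v
  end.
Notation get := (nth [::]).

Lemma size_upd r j v : size (upd r j v) = size r.
Proof. by elim: r j => [|x r IH] [|j] //=; rewrite IH. Qed.

Lemma get_upd r j v k : j < size r -> get (upd r j v) k = if k == j then v else get r k.
Proof. by elim: r j k => [|x r IH] [|j] [|k] //= jr; rewrite IH. Qed.

Lemma upd_drop r j v : j < size r -> upd r j v = take j r ++ v :: drop j.+1 r.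
Proof. by elim: r j => [|x r IH] [|j] //= jr; rewrite ?drop0 // IH. Qed.

Definition fpre (rs : seq (seq bool)) : seq sym := flatten [seq rcons (map Bit a) Sep | a <- rs].

Lemma flat_cat rs s : s <> [::] -> flat (rs ++ s) = fpre rs ++ flat s.
Proof.
move=> s0; elim: rs => [|a rs IH] //=.
rewrite IH /fpre /= cat_rcons -catA; case: rs {IH} => //=; first by case: s s0.
Qed.

Lemma solid_cat s t : solid (s ++ t) = solid s && solid t.
Proof. exact: all_cat. Qed.

Lemma solid_bits s : solid (map Bit s).
Proof. by elim: s. Qed.

Lemma solid_fpre rs : solid (fpre rs).
Proof. by elim: rs => //= a rs IH; rewrite /fpre /= solid_cat -cats1 solid_cat solid_bits. Qed.

Lemma solid_rev s : solid (rev s) = solid s.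
Proof. exact: all_rev. Qed.

(** A step that leaves a tape alone still writes the scanned symbol back, which turns an implicit
    blank beyond the end of the list into an explicit one. [touch] records this effect. *)
Definition touch (t : tape) := Tape (tl t) (if tr t is [::] then [:: Blank] else tr t).

Lemma write_head t : write_sym t (head_sym t) = touch t.
Proof. by case: t => l [|a r]. Qed.

Lemma touchK t : touch (touch t) = touch t.
Proof. by case: t => l [|a r]. Qed.

(** The first move is unconditional because in iterated use the head already rests on a
    separator. *)
Definition left_sep : pM unit :=
  @PM unit bool false
    (fun q a1 a2 _ => if q then
        if a2 is Sep then PStep (inr tt) a1 Stay a2 Stay else PStep (inl true) a1 Stay a2 MoveL
      else PStep (inl true) a1 Stay a2 MoveL)
    (fun _ => false).

Lemma reach_left_sep O a l h r t1 y :
  reach O (m := left_sep) (size a + 2) false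
    (t1, Tape (map Bit a ++ Sep :: l) (h :: r), y) tt
    (touch t1, Tape l (Sep :: rev (map Bit a) ++ h :: r), y).
Proof.
have aux : forall a h r t1, reach O (m := left_sep) (size a + 1) true
    (t1, Tape (behead (map Bit a ++ Sep :: l)) (head Blank (map Bit a ++ Sep :: l) :: h :: r), y) tt
    (touch t1, Tape l (Sep :: rev (map Bit a) ++ h :: r), y).
  elim=> [|b s IH] {}h {}r {}t1; rewrite /= ?add0n.
    by apply: reach1; rewrite /pstep /= write_head.
  have := IH (Bit b) (h :: r) (touch t1); rewrite touchK => H.
  rewrite rev_cons cat_rcons.
  apply: reachS H; rewrite /pstep /= write_head.
  by case: s {IH}.
have := aux a h r (touch t1); rewrite touchK => H.
have -> : size a + 2 = (size a + 1).+1 by lia.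
apply: reachS H; rewrite /pstep /= write_head.
by case: a {aux}.
Qed.

Fixpoint seek (j : nat) : pM unit :=
  if j is j'.+1 then bind left_sep (fun _ => seek j') else ret tt.

Lemma reach_seek O j rs r h t1 y : j < size rs ->
  exists2 n, n <= size (fpre (take j rs)) + j + 1 &
  reach O (m := seek j) n (p0 (seek j)) (t1, Tape (flat rs) (h :: r), y) tt
    (touch t1, Tape (flat (drop j rs)) (rev (fpre (take j rs)) ++ h :: r), y).
Proof.
elim: j rs r h t1 => [|j IH] rs r h t1 jr.
  exists 1; rewrite ?leq_addl // take0 drop0 /=; apply: reach1; by rewrite /pstep /= write_head.
case: rs jr => [|a rs] //= jr.
have rs0 : rs <> [::] by move=> e; rewrite e in jr.
have [n le_n r2] := IH rs (rev (map Bit a) ++ h :: r) Sep (touch t1) jr.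
exists (size a + 2 + n).
  rewrite /fpre /= size_cat size_rcons size_map; rewrite /fpre in le_n; lia.
rewrite touchK in r2.
have -> : (if rs is [::] then [::] else Sep :: flat rs) = Sep :: flat rs by case: rs rs0 {jr IH r2 le_n}.
apply: (reach_bind (m := left_sep)); first exact: reach_left_sep.
by rewrite /fpre /= rev_cat rev_rcons -catA /=.
Qed.

(** Insertion of [a] at the head: the state holds the symbol displaced last, and everything to the
    right shifts by one cell until a blank is overwritten. *)
Definition carry (a : sym) : pM unit :=
  @PM unit sym a
    (fun q a1 a2 _ => PStep (if is_blank a2 then inr tt else inl a2) a1 Stay q MoveR)
    (fun _ => false).

Lemma reach_carry O a u l r t1 y : solid u -> blank r ->
  reach O (m := carry a) (size u + 1) a (t1, Tape l (u ++ r), y) tt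
    (touch t1, Tape (rev u ++ a :: l) (behead r), y).
Proof.
(* The induction changes the symbol in hand but not the start state of the fragment, so the two are
   given different names. *)
suff H a0 : solid u -> blank r ->
  reach O (m := carry a0) (size u + 1) a (t1, Tape l (u ++ r), y) tt
    (touch t1, Tape (rev u ++ a :: l) (behead r), y) by exact: H.
elim: u a l t1 => [|b u IH] a l t1 /= su br.
  by apply: reach1; rewrite /pstep /= write_head; case: r br => [|[]].
case/andP: su => sb su; have := IH b (a :: l) (touch t1) su br; rewrite touchK => H.
rewrite rev_cons cat_rcons addSn; apply: reachS H.
by rewrite /pstep /=; case: b sb {IH} => //= *; rewrite write_head.
Qed.

Definition top : pM (option bool) :=
  @PM (option bool) bool false
    (fun q a1 a2 _ => if q then PStep (inr (if a2 is Bit b then Some b else None)) a1 Stay a2 Stay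
                      else PStep (inl true) a1 Stay a2 MoveL)
    (fun _ => false).

Lemma reach_top_some O b l h r t1 y :
  reach O (m := top) 2 false (t1, Tape (Bit b :: l) (h :: r), y) (Some b)
    (touch t1, Tape l (Bit b :: h :: r), y).
Proof.
apply: (@reachS _ _ _ _ _ _ (true : pst top)); first by rewrite /pstep /=.
by apply: reach1; rewrite /pstep /= !write_head touchK.
Qed.

(** If the empty register is the last one, the head is at the left end of the tape, the move to the
    left has no effect and [h] itself is read. Hence [h] must not be a bit. *)
Lemma reach_top_none O rs h r t1 y : h <> Bit true -> h <> Bit false ->
  exists l' u, [/\ rev u ++ l' = flat ([::] :: rs), solid u &
  reach O (m := top) 2 false (t1, Tape (flat ([::] :: rs)) (h :: r), y) None
    (touch t1, Tape l' (u ++ h :: r), y)].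
Proof.
move=> h1 h2; case: rs => [|a rs].
  exists [::], [::]; split=> //.
  apply: (@reachS _ _ _ _ _ _ (true : pst top)); first by rewrite /pstep /=.
  by apply: reach1; rewrite /pstep /= !write_head touchK; case: h h1 h2 => [|[]|].
exists (flat (a :: rs)), [:: Sep]; split=> //.
apply: (@reachS _ _ _ _ _ _ (true : pst top)); first by rewrite /pstep /=.
by apply: reach1; rewrite /pstep /= !write_head touchK.
Qed.

Definition home : pM unit :=
  @PM unit unit tt
    (fun q a1 a2 _ => if is_blank a2 then PStep (inr tt) a1 Stay a2 Stay
                      else PStep (inl tt) a1 Stay a2 MoveR)
    (fun _ => false).

Lemma reach_home O u l r t1 y : solid u -> blank r ->
  exists2 r', blank r' &
  reach O (m := home) (size u + 1) tt (t1, Tape l (u ++ r), y) tt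
    (touch t1, Tape (rev u ++ l) r', y).
Proof.
elim: u l t1 => [|b u IH] l t1 /= su br.
  exists (if r is [::] then [:: Blank] else r); first by case: r br.
  by apply: reach1; rewrite /pstep /=; case: r br => [|[] r] //= br; rewrite write_head.
case/andP: su => sb su; have [r' br' H] := IH (b :: l) (touch t1) su br.
exists r' => //; rewrite touchK in H.
rewrite rev_cons cat_rcons addSn; apply: reachS H.
by rewrite /pstep /=; case: b sb {IH} => //= *; rewrite write_head.
Qed.

(* Moves every symbol to the right of the head one cell to the left. The states
   are: [None] on the hole, [Some None] right of it, [Some (Some a)] back on
   the hole with the symbol [a] to be written there. *)
Definition close_gap : pM unit :=
  @PM unit (option (option sym)) None
    (fun q a1 a2 _ => match q with
      | None => PStep (inl (Some None)) a1 Stay a2 MoveR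
      | Some None => PStep (inl (Some (Some a2))) a1 Stay a2 MoveL
      | Some (Some a) => if is_blank a then PStep (inr tt) a1 Stay a Stay
                         else PStep (inl None) a1 Stay a MoveR
      end)
    (fun _ => false).

Lemma reach_close_gap O h u l r t1 y : solid u -> blank r ->
  exists2 r', blank r' &
  reach O (m := close_gap) (3 * size u + 3) None (t1, Tape l (h :: u ++ r), y) tt
    (touch t1, Tape (rev u ++ l) r', y).
Proof.
elim: u l h t1 => [|b u IH] l h t1 /= su br.
  have hb l' : head_sym (Tape l' r) = Blank by case: r br => [|[]].
  exists [:: Blank, Blank & behead r]; first by case: r br {hb} => //= a r /andP[].
  rewrite muln0.
  apply: (@reachS _ _ _ _ _ _ (Some None : pst close_gap)); first by rewrite /pstep /= write_head.
  apply: (@reachS _ _ _ _ _ _ (Some (Some Blank) : pst close_gap)).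
    by rewrite /pstep /= write_head touchK hb.
  by apply: reach1; rewrite /pstep /= write_head touchK.
case/andP: su => sb su; have [r' br' H] := IH (b :: l) b (touch t1) su br.
exists r' => //; rewrite touchK in H.
rewrite rev_cons cat_rcons mulnS -addnA.
apply: (@reachS _ _ _ _ _ _ (Some None : pst close_gap)); first by rewrite /pstep /= ?write_head ?touchK.
apply: (@reachS _ _ _ _ _ _ (Some (Some b) : pst close_gap)); first by rewrite /pstep /= ?write_head ?touchK.
apply: reachS H; rewrite /pstep /= ?write_head ?touchK.
by case: b sb {IH} => //= *; rewrite ?write_head ?touchK //.
Qed.

(* Registers, unread part of the first tape, unused choice bits. *)
Record cfg := Cfg { regs : seq (seq bool); inp : seq sym; cho : seq bool }.

Definition fsize (r : seq (seq bool)) := size (flat r).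

Inductive rep (s : cfg) : tcfg -> Prop :=
  Rep t1 l2 r2 m : tr t1 = inp s ++ nseq m Blank -> l2 = flat (regs s) -> blank r2 ->
    rep s (t1, Tape l2 r2, cho s).

(* [t] counts operations. An operation takes time linear in the size of the
   registers, which it increases by at most one; hence the quadratic bound on
   the number of steps. *)
Definition Exec O F (m : pM F) (s : cfg) (f : F) (s' : cfg) (t : nat) : Prop :=
  fsize (regs s') <= fsize (regs s) + t /\
  forall c, rep s c -> exists n c',
    [/\ n <= 8 * t * (fsize (regs s) + t), rep s' c' & reach O (m := m) n (p0 m) c f c'].

Lemma Exec_le O F (m : pM F) s f s' t t' : Exec O m s f s' t -> t <= t' -> Exec O m s f s' t'.
Proof.
case=> hs h le; split; first by lia.
move=> c /h[n [c' [hn r' e]]]; exists n, c'; split=> //.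
by apply: leq_trans hn _; apply: leq_mul; lia.
Qed.

(** The registers may have grown by [t1] when the second fragment starts;
    [fsize (regs s) + (t1 + t2)] still bounds its size factor, so both costs are compared with this
    common factor. *)
Lemma Exec_bind O (F : finType) G (m : pM F) (N : F -> pM G) s f s1 g s2 t1 t2 :
  Exec O m s f s1 t1 -> Exec O (N f) s1 g s2 t2 -> Exec O (bind m N) s g s2 (t1 + t2).
Proof.
case=> h1 e1 [h2 e2]; split; first by lia.
move=> c /e1[n1 [c1 [hn1 r1 x1]]]; have [n2 [c2 [hn2 r2 x2]]] := e2 _ r1.
exists (n1 + n2), c2; split=> //; last exact: reach_bind x1 x2.
have : 8 * t2 * (fsize (regs s1) + t2) <= 8 * t2 * (fsize (regs s) + (t1 + t2)).
  by apply: leq_mul => //; lia.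
have : 8 * t1 * (fsize (regs s) + t1) <= 8 * t1 * (fsize (regs s) + (t1 + t2)).
  by apply: leq_mul => //; lia.
move: (fsize _ + (t1 + t2)) => z; rewrite mulnDr mulnDl; lia.
Qed.

Lemma Exec_loop_stop O (A : finType) B (body : A -> pM (A + B)) a s b s' t :
  Exec O (body a) s (inr b) s' t -> Exec O (loop body a) s b s' t.
Proof.
case=> h e; split=> // c /e[n [c' [hn r x]]]; exists n, c'; split=> //.
exact: reach_loop_stop.
Qed.

Lemma Exec_loop_next O (A : finType) B (body : A -> pM (A + B)) a a' s s1 b s2 t1 t2 :
  Exec O (body a) s (inl a') s1 t1 -> Exec O (loop body a') s1 b s2 t2 ->
  Exec O (loop body a) s b s2 (t1 + t2).
Proof.
case=> h1 e1 [h2 e2]; split; first by lia.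
move=> c /e1[n1 [c1 [hn1 r1 x1]]]; have [n2 [c2 [hn2 r2 x2]]] := e2 _ r1.
exists (n1 + n2), c2; split=> //; last exact: reach_loop_next x1 x2.
have : 8 * t2 * (fsize (regs s1) + t2) <= 8 * t2 * (fsize (regs s) + (t1 + t2)).
  by apply: leq_mul => //; lia.
have : 8 * t1 * (fsize (regs s) + t1) <= 8 * t1 * (fsize (regs s) + (t1 + t2)).
  by apply: leq_mul => //; lia.
move: (fsize _ + (t1 + t2)) => z; rewrite mulnDr mulnDl; lia.
Qed.

(** * Primitive operations on registers, input, choice bits and oracle *)

Lemma tr_touch t i m : tr t = i ++ nseq m Blank -> exists m', tr (touch t) = i ++ nseq m' Blank.
Proof.
case: t => l [|a r] /= e; last by exists m.
by case: i e => [|//] e; exists 1.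
Qed.

Lemma blank_touch l r : blank r -> exists2 r', touch (Tape l r) = Tape l (Blank :: r') & blank r'.
Proof. by case: r => [|[] r] //= br; [exists [::]|exists r]. Qed.

Lemma reach_ret O F (f : F) t1 t2 y :
  reach O (m := ret f) 1 tt (t1, t2, y) f (touch t1, touch t2, y).
Proof. by apply: reach1; rewrite /pstep /= !write_head. Qed.

Lemma Exec_ret O F (f : F) s : Exec O (ret f) s f s 1.
Proof.
split=> [|_ [t1 l2 r2 m e1 e2 br]]; first by lia.
exists 1, (touch t1, touch (Tape l2 r2), cho s); split; first by lia.
- have [m' e'] := tr_touch e1; have [r' -> br'] := blank_touch l2 br.
  exact: Rep e' e2 _.
- exact: reach_ret.
Qed.

Lemma flat_take_drop r j : j < size r -> flat r = fpre (take j r) ++ flat (drop j r).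
Proof.
move=> jr; rewrite -flat_cat ?cat_take_drop //.
by move/(congr1 size); rewrite size_drop /=; lia.
Qed.

Lemma fsize_split r j : j < size r ->
  fsize r = size (fpre (take j r)) + size (flat (drop j r)).
Proof. by move=> jr; rewrite /fsize (flat_take_drop jr) size_cat. Qed.

Lemma fpre_ge rs : size rs <= size (fpre rs).
Proof. by elim: rs => //= a rs IH; rewrite /fpre /= size_cat size_rcons; rewrite /fpre in IH; lia. Qed.

Lemma flat_drop r j : j < size r ->
  flat (drop j r) = map Bit (get r j) ++ (if drop j.+1 r is [::] then [::] else Sep :: flat (drop j.+1 r)).
Proof. by move=> jr; rewrite (drop_nth [::] jr). Qed.

Lemma flat_upd r j v : j < size r ->
  flat (upd r j v) = fpre (take j r) ++ map Bit v ++
     (if drop j.+1 r is [::] then [::] else Sep :: flat (drop j.+1 r)).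
Proof. by move=> jr; rewrite upd_drop // flat_cat. Qed.

Lemma fpre_sep_rev rs s : exists h u, rev (fpre rs) ++ Blank :: s = h :: u /\
  (h <> Bit true /\ h <> Bit false).
Proof.
case/lastP: rs => [|rs a]; first by exists Blank, s.
rewrite /fpre map_rcons flatten_rcons rev_cat rev_rcons /=.
by eexists; eexists; split; first by [].
Qed.

(** The initial [ret tt] makes the scanned cell explicit: the lemma on [seek] assumes a nonempty
    list from the head on. The same holds for [pop]. *)
Definition push (j : nat) (b : bool) : pM unit :=
  bind (ret tt) (fun _ => bind (seek j) (fun _ => carry (Bit b))).

Lemma Exec_push O j b r i y : j < size r ->
  Exec O (push j b) (Cfg r i y) tt (Cfg (upd r j (b :: get r j)) i y) 1.
Proof.
move=> jr; have e := flat_drop jr.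
split=> [/=|_ [t1 l2 r2 m e1 e2 br]].
  by rewrite /fsize flat_upd // [X in _ <= X + _](fsize_split jr) e !size_cat /=; lia.
have [m' e'] := tr_touch e1; have [r' tr' br'] := blank_touch l2 br.
move: e1 e2 => /= e1 e2.
have [n hn x] := reach_seek O r' Blank (touch t1) y jr.
set u := fpre _ in x hn.
have := @reach_carry O (Bit b) (rev u) (flat (drop j r)) (Blank :: r') (touch t1) y.
rewrite solid_rev solid_fpre => /(_ isT br') z.
exists (1 + (n + (size (rev u) + 1))); eexists; split; last first.
- apply: reach_bind; first exact: reach_ret.
  rewrite touchK in x; apply: reach_bind; last exact: z.
  by rewrite tr' e2; exact: x.
- rewrite revK touchK; apply: Rep br' => //=; first exact: e'.
  by rewrite flat_upd // e.
- rewrite size_rev /= (fsize_split jr); have := fpre_ge (take j r).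
  rewrite size_take jr -/u; lia.
Qed.

Definition pop (j : nat) : pM (option bool) :=
  bind (ret tt) (fun _ => bind (seek j) (fun _ => bind top (fun o =>
    if o is Some b then bind close_gap (fun _ => ret (Some b))
    else bind home (fun _ => ret None)))).

Lemma Exec_pop O j r i y : j < size r ->
  Exec O (pop j) (Cfg r i y) (ohead (get r j)) (Cfg (upd r j (behead (get r j))) i y) 1.
Proof.
move=> jr; have e := flat_drop jr.
split=> [/=|_ [t1 l2 r2 m e1 e2 br]].
  rewrite /fsize flat_upd // [X in _ <= X + _](fsize_split jr) e !size_cat !size_map size_behead; lia.
have [m' e'] := tr_touch e1; have [r' tr' br'] := blank_touch l2 br.
move: e1 e2 => /= e1 e2.
have [n hn x] := reach_seek O r' Blank (touch t1) y jr.
set u := fpre _ in x hn.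
have := fpre_ge (take j r); rewrite size_take jr -/u => ju.
have [h [w [ew [h1 h2]]]] := fpre_sep_rev (take j r) r'.
rewrite -/u in ew; rewrite touchK in x.
have su : solid (rev u) by rewrite solid_rev solid_fpre.
case eg: (get r j) => [|b a] /=.
- have [rs ers] : exists rs, drop j r = [::] :: rs.
    by rewrite (drop_nth [::] jr) eg; eexists.
  have [l' [v [ev sv z]]] := @reach_top_none O rs h w (touch t1) y h1 h2.
  have sv' : solid (v ++ rev u) by rewrite solid_cat sv.
  have [r'' br'' zz] := @reach_home O (v ++ rev u) l' (Blank :: r') (touch t1) y sv' br'.
  have [r3 t3 br3] := blank_touch (flat r) br''.
  exists (1 + (n + (2 + ((size (v ++ rev u) + 1) + 1)))); eexists; split; last first.
  + apply: reach_bind; first exact: reach_ret.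
    apply: reach_bind; first by rewrite tr' e2; exact: x.
    apply: (reach_bind (m := top)); first by rewrite ers ew; exact: z.
    apply: (reach_bind (m := home)).
      by rewrite -ew touchK catA; exact: zz.
    exact: reach_ret.
  + rewrite !touchK.
    have -> : rev (v ++ rev u) ++ l' = flat r.
      by rewrite rev_cat revK -catA ev -ers -flat_take_drop.
    rewrite t3; apply: Rep => //=; first exact: e'.
    by rewrite flat_upd // (flat_take_drop jr) e eg.
  + have : size v <= size (flat (drop j r)).
      by rewrite ers -ev size_cat size_rev; lia.
    rewrite size_cat size_rev /= (fsize_split jr) -/u; lia.
- have ed : flat (drop j r) = Bit b :: behead (flat (drop j r)) by rewrite e eg.
  have z := @reach_top_some O b (behead (flat (drop j r))) h w (touch t1) y.
  have [r'' br'' zz] := @reach_close_gap O (Bit b) (rev u) (behead (flat (drop j r)))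
     (Blank :: r') (touch t1) y su br'.
  have [r3 t3 br3] := blank_touch (u ++ behead (flat (drop j r))) br''.
  exists (1 + (n + (2 + ((3 * size (rev u) + 3) + 1)))); eexists; split; last first.
  + apply: reach_bind; first exact: reach_ret.
    apply: reach_bind; first by rewrite tr' e2; exact: x.
    apply: (reach_bind (m := top)); first by rewrite ed ew; exact: z.
    apply: (reach_bind (m := close_gap)).
      by rewrite -ew touchK; exact: zz.
    exact: reach_ret.
  + rewrite revK !touchK t3; apply: Rep => //=; first exact: e'.
    by rewrite flat_upd // e eg.
  + rewrite size_rev /= (fsize_split jr) -/u; lia.
Qed.

Definition newreg : pM unit :=
  @PM unit unit tt (fun _ a1 _ _ => PStep (inr tt) a1 Stay Sep MoveR) (fun _ => false).

Lemma Exec_newreg O r i y : r <> [::] ->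
  Exec O newreg (Cfg r i y) tt (Cfg ([::] :: r) i y) 1.
Proof.
move=> r0; have e : flat ([::] :: r) = Sep :: flat r by case: r r0.
split=> [/=|_ [t1 l2 r2 m e1 e2 br]]; first by rewrite /fsize e /=; lia.
have [m' e'] := tr_touch e1.
exists 1; eexists; split; [by lia| |by apply: reach1].
rewrite write_head /=; apply: Rep; [exact: e'|by rewrite e e2|by case: r2 br => //= a s /andP[]].
Qed.

Definition read : pM sym :=
  @PM sym unit tt (fun _ a1 a2 _ => PStep (inr a1) a1 MoveR a2 Stay) (fun _ => false).

Lemma Exec_read O r i y :
  Exec O read (Cfg r i y) (head Blank i) (Cfg r (behead i) y) 1.
Proof.
split=> [|_ [t1 l2 r2 m e1 e2 br]] /=; first by lia.
have [m' e'] := tr_touch e1; have [r' tr' br'] := blank_touch l2 br.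
exists 1; eexists; split; [by lia| |].
  2: { apply: reach1; rewrite /pstep /= !write_head tr'.
       have -> : head_sym t1 = head Blank i.
         rewrite /= in e1; rewrite /head_sym e1.
         by case: (i); case: (m).
       by []. }
apply: (@Rep _ _ _ _ (if i is [::] then m'.-1 else m')) => //.
rewrite [LHS](_ : _ = behead (tr (touch t1))); last by case: (t1) => l [|].
by rewrite e' /=; case: (i); case: (m').
Qed.

Definition choose : pM bool :=
  @PM bool unit tt (fun _ a1 a2 c => PStep (inr c) a1 Stay a2 Stay) (fun _ => true).

Lemma Exec_choose O r i y :
  Exec O choose (Cfg r i y) (head false y) (Cfg r i (behead y)) 1.
Proof.
split=> [|_ [t1 l2 r2 m e1 e2 br]] /=; first by lia.
exists 1, (touch t1, touch (Tape l2 r2), behead y); split; first by lia.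
- have [m' e'] := tr_touch e1; have [r' -> br'] := blank_touch l2 br.
  exact: (@Rep (Cfg r i (behead y)) _ _ _ _ e' e2).
- by apply: reach1; rewrite /pstep /= !write_head.
Qed.

Lemma bits_prefix_flat rs z : rs <> [::] -> (if z is Bit _ :: _ then false else true) ->
  bits_prefix (rev (flat rs) ++ z) = rev (last [::] rs).
Proof.
have aux s w : (if w is Bit _ :: _ then false else true) -> bits_prefix (map Bit s ++ w) = s.
  by move=> hw; elim: s => /= [|b s ->] //; case: w hw => [|[]].
elim: rs z => // a [|a' rs] IH z _ hz.
  by rewrite /= cats0 -map_rev aux.
rewrite [flat _]/= rev_cat rev_cons cat_rcons -catA.
by rewrite (IH (Sep :: _)).
Qed.

Definition ask : pM bool :=
  @PM bool unit tt (fun _ _ _ _ => PAsk (inr true) (inr false)) (fun _ => false).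

Lemma Exec_ask (O : oracle) r i y : r <> [::] ->
  Exec O ask (Cfg r i y) (O (rev (last [::] r))) (Cfg r i y) 1.
Proof.
move=> r0; split=> [|_ [t1 l2 r2 m e1 e2 br]] /=; first by lia.
exists 1; eexists; split; [by lia| |apply: reach1].
  2: { rewrite /pstep /= /query_string /= e2 bits_prefix_flat //.
       - by case: (O _).
       - by case: r2 br {e2 e1} => [|[]]. }
exact: (@Rep (Cfg r i y) _ _ _ _ e1 erefl br).
Qed.

Fixpoint boot (K : nat) F (m : pM F) : pM F :=
  if K is K'.+1 then bind newreg (fun _ => boot K' m) else m.

Lemma Exec_boot O K F (m : pM F) i y f s' t :
  Exec O m (Cfg (nseq K.+1 [::]) i y) f s' t ->
  Exec O (boot K m) (Cfg [:: [::]] i y) f s' (K + t).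
Proof.
rewrite /nseq /ncons iterSr; have : [:: [::]] <> [::] :> seq (seq bool) by [].
move: [:: [::]] => r r0; elim: K r r0 => [|K IH] r r0 /= e; first exact: e.
rewrite -add1n -addnA; apply: Exec_bind; first exact: Exec_newreg.
by apply: IH => //; rewrite -iterSr.
Qed.

(** * From fragments to machines *)

Section ToTM.
Variable m : pM (option bool).
Definition tm_delta (s : pst m + option bool) (a1 a2 : sym) (c : bool) :
    action (pst m + option bool)%type :=
  match s with
  | inr o => Halt o
  | inl q => match pd q a1 a2 (pch q && c) with
             | PStep q' b1 m1 b2 m2 => Step q' b1 m1 b2 m2
             | PAsk qy qn => Query qy qn
             end
  end.
Definition toTM : TM := @Build_TM (pst m + option bool)%type (inl (p0 m)) tm_delta.

(* The choice bits come from a list, consumed only in the states that use them. *)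
Fixpoint runL (O : oracle) (fuel : nat) (q : pst m + option bool) (c : tcfg) : option (option bool) :=
  if fuel is fuel'.+1 then
    match q with
    | inr o => Some o
    | inl q => let: (q', c') := pstep O q c in runL O fuel' q' c'
    end
  else None.

(** The list keeps the bits [c i] of exactly those steps whose state looks at its choice. Which
    steps these are depends on the run, so the list is found by induction along it. *)
Lemma runL_run O c fuel i q t1 t2 :
  exists y, run (M := toTM) O c fuel i q t1 t2 = runL O fuel q (t1, t2, y).
Proof.
elim: fuel i q t1 t2 => [|fuel IH] i q t1 t2; first by exists [::].
case: q => [q|o] /=; last by exists [::].
case e: (pd _ _ _ _) => [q' b1 m1 b2 m2|qy qn].
- have [y ey] := IH i.+1 q' (move_tape m1 (write_sym t1 b1)) (move_tape m2 (write_sym t2 b2)).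
  exists (if pch q then c i :: y else y).
  by rewrite ey; case: (pch q) e => /= ->.
- have [y ey] := IH i.+1 (if O (query_string t2) then qy else qn) t1 t2.
  exists (if pch q then c i :: y else y).
  by rewrite ey; case: (pch q) e => /= ->.
Qed.

Lemma run_ext (M : TM) O c c' fuel i (q : state M) t1 t2 :
  (forall j, i <= j < i + fuel -> c j = c' j) ->
  run O c fuel i q t1 t2 = run O c' fuel i q t1 t2.
Proof.
elim: fuel i q t1 t2 => // fuel IH i q t1 t2 h /=.
have -> : c i = c' i by apply: h; lia.
by case: (delta _ _ _ _) => [//|q' b1 m1 b2 m2|qy qn]; apply: IH => j hj; apply: h; lia.
Qed.

(** The stream is built from the end of the run: the current head of the list is placed at index
    [i], and this does not disturb the later steps, which read larger indices only. *)
Lemma run_runL O y fuel i q t1 t2 :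
  exists c, run (M := toTM) O c fuel i q t1 t2 = runL O fuel q (t1, t2, y).
Proof.
elim: fuel i q t1 t2 y => [|fuel IH] i q t1 t2 y; first by exists (fun _ => false).
case: q => [q|o] /=; last by exists (fun _ => false).
case e: (pd q _ _ (pch q && head false y)) => [q' b1 m1 b2 m2|qy qn].
- have [c ec] := IH i.+1 q' (move_tape m1 (write_sym t1 b1)) (move_tape m2 (write_sym t2 b2))
    (if pch q then behead y else y).
  exists (fun j => if j == i then head false y else c j); rewrite eqxx e -ec.
  by apply: run_ext => j hj; case: eqP => // ?; lia.
- have [c ec] := IH i.+1 (if O (query_string t2) then qy else qn) t1 t2
    (if pch q then behead y else y).
  exists (fun j => if j == i then head false y else c j); rewrite eqxx e -ec.
  by apply: run_ext => j hj; case: eqP => // ?; lia.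
Qed.

Lemma run_runL_nil O fuel i q t1 t2 :
  run (M := toTM) O det_choices fuel i q t1 t2 = runL O fuel q (t1, t2, [::]).
Proof.
elim: fuel i q t1 t2 => // fuel IH i [q|o] t1 t2 //=.
rewrite if_same /det_choices.
by case: (pd _ _ _ _) => [q' b1 m1 b2 m2|qy qn]; rewrite IH.
Qed.

Lemma runL_reach O n fuel q c o c' : reach O n q c o c' -> n < fuel -> runL O fuel (inl q) c = Some o.
Proof.
move=> x; elim: x fuel => [{}q {}c {}o {}c' e|{}n {}q {}c q1 c1 {}o {}c' e _ IH] [|fuel] //= h.
  by rewrite e; case: fuel h.
by rewrite e; apply: IH.
Qed.

Definition resultL O y w T := runL O T (inl (p0 m)) (Tape [::] w, Tape [::] [::], y).

(** The registers start with size 0, so the bound in [Exec] becomes [8 * t * t]; the strict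
    inequality leaves one step for [Halt]. *)
Lemma resultL_Exec O y w T o s' t :
  Exec O m (Cfg [:: [::]] w y) o s' t -> 8 * t * t < T -> resultL O y w T = Some o.
Proof.
case=> _ /(_ (Tape [::] w, Tape [::] [::], y)) [].
  by apply: (@Rep (Cfg [:: [::]] w y) _ _ _ 0); rewrite //= cats0.
move=> n [c' [hn _ x]] hT; apply: (runL_reach x).
by apply: leq_ltn_trans hT; rewrite add0n in hn.
Qed.

Lemma resultL_result O c w T : exists y, result toTM O c w T = resultL O y w T.
Proof. exact: runL_run. Qed.
Lemma result_resultL O y w T : exists c, result toTM O c w T = resultL O y w T.
Proof. exact: run_runL. Qed.
Lemma result_det O w T : result toTM O det_choices w T = resultL O [::] w T.
Proof. exact: run_runL_nil. Qed.
End ToTM.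

Lemma run_fuel (M : TM) O c fuel fuel' i (q : state M) t1 t2 o :
  run O c fuel i q t1 t2 = Some o -> fuel <= fuel' -> run O c fuel' i q t1 t2 = Some o.
Proof.
elim: fuel fuel' i q t1 t2 => // fuel IH [|fuel'] // i q t1 t2 /=.
by case: (delta _ _ _ _) => [//|q' b1 m1 b2 m2|qy qn] h hf; apply: IH h _.
Qed.

Lemma result_fuel (M : TM) O c w T T' o :
  result M O c w T = Some o -> T <= T' -> result M O c w T' = Some o.
Proof. exact: run_fuel. Qed.

Lemma result_ext (M : TM) O c c' w T :
  (forall j, j < T -> c j = c' j) -> result M O c w T = result M O c' w T.
Proof. by move=> h; apply: run_ext => j /andP[_]; apply: h. Qed.

#[global] Opaque bind loop ret push pop read choose ask newreg.

(** * Subroutines *)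

Notation "x <- m ;; k" := (bind m (fun x => k))
  (at level 61, m at next level, right associativity).
Notation "m ;;; k" := (bind m (fun _ => k)) (at level 61, right associativity).

Ltac xstep lem := eapply Exec_bind; [eapply lem; try done | simpl].

Ltac reg_eq :=
  apply: (@eq_from_nth _ [::]); [by rewrite ?size_upd |];
  let k := fresh "k" in let hk := fresh "hk" in
  move=> k hk; rewrite ?get_upd ?size_upd //;
  repeat (case: eqP => // ?); subst; try done; try congruence; try lia.

Ltac reg_get :=
  rewrite ?get_upd ?size_upd ?eqxx //; repeat (case: eqP => ?; try (exfalso; lia)); try done.

Lemma upd_get r j : upd r j (get r j) = r.
Proof. by elim: r j => [|x r IH] [|j] //=; rewrite IH. Qed.

Lemma upd_upd r j v w : upd (upd r j v) j w = upd r j w.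
Proof. by elim: r j => [|x r IH] [|j] //=; rewrite IH. Qed.

Lemma nseq_catS n (b : bool) s : nseq n b ++ b :: s = b :: nseq n b ++ s.
Proof. by elim: n => //= n ->. Qed.

Definition forpop (j : nat) (body : bool -> pM unit) : pM unit :=
  loop (fun _ : unit => o <- pop j ;;
    if o is Some b then body b ;;; ret (inl tt) else ret (inr tt)) tt.

Lemma Exec_forpop_nil O j body r i y : j < size r -> get r j = [::] ->
  Exec O (forpop j body) (Cfg r i y) tt (Cfg r i y) 2.
Proof.
move=> jr e; apply: Exec_loop_stop.
have -> : 2 = 1 + 1 by []; eapply Exec_bind; first exact: Exec_pop.
have e' := upd_get r j; rewrite e in e'.
rewrite e /= e'; exact: Exec_ret.
Qed.

Lemma Exec_forpop_cons O j body r i y b a s1 s2 t1 t2 : j < size r -> get r j = b :: a ->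
  Exec O (body b) (Cfg (upd r j a) i y) tt s1 t1 ->
  Exec O (forpop j body) s1 tt s2 t2 ->
  Exec O (forpop j body) (Cfg r i y) tt s2 (t1 + 2 + t2).
Proof.
move=> jr e h1 h2; apply: Exec_loop_next h2.
have -> : t1 + 2 = 1 + (t1 + 1) by lia.
eapply Exec_bind; first exact: Exec_pop.
rewrite e /=; eapply Exec_bind; first exact: h1.
exact: Exec_ret.
Qed.
#[global] Opaque forpop.

Definition clear j := forpop j (fun _ => ret tt).

Lemma Exec_clear O j r i y : j < size r ->
  Exec O (clear j) (Cfg r i y) tt (Cfg (upd r j [::]) i y) (3 * size (get r j) + 2).
Proof.
move=> jr; move e: (get r j) => a; elim: a r jr e => [|b a IH] r jr e.
  have e' := upd_get r j; rewrite e in e'; rewrite e'; exact: Exec_forpop_nil.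
eapply Exec_le.
  eapply (Exec_forpop_cons jr e); first exact: Exec_ret.
  by have := IH (upd r j a); rewrite size_upd get_upd // eqxx upd_upd; apply.
by rewrite /=; lia.
Qed.

Definition mv j k := forpop j (fun b => push k b).

Lemma Exec_mv O j k r i y : j < size r -> k < size r -> j <> k ->
  Exec O (mv j k) (Cfg r i y) tt
    (Cfg (upd (upd r j [::]) k (rev (get r j) ++ get r k)) i y) (3 * size (get r j) + 2).
Proof.
move=> jr kr jk; move e: (get r j) => a; elim: a r jr kr e => [|b a IH] r jr kr e.
  have e' := upd_get r j; rewrite e in e'; rewrite e' /= upd_get; exact: Exec_forpop_nil.
eapply Exec_le.
  eapply (Exec_forpop_cons jr e); first by apply: Exec_push; rewrite size_upd.
  set r1 := upd _ k _.
  have := IH r1; rewrite !size_upd => /(_ jr kr).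
  have -> : get r1 j = a by rewrite /r1 !get_upd ?size_upd // eqxx; case: eqP.
  have -> : get r1 k = b :: get r k by rewrite /r1 !get_upd ?size_upd // eqxx; case: eqP => // ?; lia.
  move=> /(_ erefl).
  set r2 := upd _ k _; set r3 := upd _ k _; suff -> : r2 = r3 by apply.
  rewrite /r2 /r3 /r1; reg_eq.
  by rewrite rev_cons cat_rcons.
by rewrite /=; lia.
Qed.

Definition mvu j k l := forpop j (fun b => push k b ;;; push l true).

Lemma Exec_mvu O j k l r i y : j < size r -> k < size r -> l < size r ->
  j <> k -> j <> l -> k <> l ->
  Exec O (mvu j k l) (Cfg r i y) tt
    (Cfg (upd (upd (upd r j [::]) k (rev (get r j) ++ get r k)) l
              (nseq (size (get r j)) true ++ get r l)) i y) (4 * size (get r j) + 2).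
Proof.
move=> jr kr lr jk jl kl; move e: (get r j) => a; elim: a r jr kr lr e => [|b a IH] r jr kr lr e.
  have e' := upd_get r j; rewrite e in e'; rewrite e' /= !upd_get; exact: Exec_forpop_nil.
eapply Exec_le.
  eapply (Exec_forpop_cons jr e).
    by eapply Exec_bind; apply: Exec_push; rewrite ?size_upd.
  set r1 := upd _ l _.
  have := IH r1; rewrite !size_upd => /(_ jr kr lr).
  have -> : get r1 j = a by rewrite /r1 !get_upd ?size_upd //; do !case: eqP => //.
  have -> : get r1 k = b :: get r k by rewrite /r1 !get_upd ?size_upd //; do !case: eqP => //; lia.
  have -> : get r1 l = true :: get r l by rewrite /r1 !get_upd ?size_upd //; do !case: eqP => //; lia.
  move=> /(_ erefl).
  set r2 := upd _ l _; set r3 := upd _ l _; suff -> : r2 = r3 by apply.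
  rewrite /r2 /r3 /r1; reg_eq.
    by rewrite nseq_catS.
  by rewrite rev_cons cat_rcons.
by rewrite /=; lia.
Qed.

(** Reading a register destroys it, so its content travels through [t] and back; the second move
    undoes the reversal caused by the first. *)
Definition addu j k t := mvu j t k ;;; mv t j.

Lemma Exec_addu O j k t r i y : j < size r -> k < size r -> t < size r ->
  j <> k -> j <> t -> t <> k -> get r t = [::] ->
  Exec O (addu j k t) (Cfg r i y) tt
    (Cfg (upd r k (nseq (size (get r j)) true ++ get r k)) i y) (7 * size (get r j) + 4).
Proof.
move=> jr kr tr jk jt tk e.
eapply Exec_le.
  eapply Exec_bind; first exact: Exec_mvu.
  set r1 := upd _ k _.
  have := @Exec_mv O t j r1 i y; rewrite !size_upd => /(_ tr jr (not_eq_sym jt)).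
  have -> : get r1 t = rev (get r j).
    rewrite /r1 !get_upd ?size_upd // eqxx; case: eqP => // _; by rewrite e cats0.
  have -> : get r1 j = [::] by rewrite /r1 !get_upd ?size_upd // eqxx; do !case: eqP => //.
  rewrite revK cats0; set r2 := upd _ j _; set r3 := upd _ k _.
  have -> : r2 = r3 by rewrite /r2 /r3 /r1; reg_eq.
  exact.
by rewrite size_rev; lia.
Qed.

(** * Tape symbols in registers, two bits each *)

Definition sbits (a : sym) : seq bool :=
  match a with
  | Blank => [:: false; false] | Sep => [:: false; true] | Bit b => [:: true; b]
  end.
Definition sdec (b c : bool) : sym := if b then Bit c else if c then Sep else Blank.
Definition encs (w : seq sym) : seq bool := flatten [seq sbits a | a <- w].

Lemma encs_cat u v : encs (u ++ v) = encs u ++ encs v.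
Proof. by rewrite /encs map_cat flatten_cat. Qed.

Lemma size_encs w : size (encs w) = 2 * size w.
Proof. by elim: w => // a w IH; rewrite /encs /= size_cat -/(encs w) IH; case: a => /=; lia. Qed.

Definition pushsym j (a : sym) : pM unit :=
  push j (nth false (sbits a) 1) ;;; push j (nth false (sbits a) 0).

Lemma Exec_pushsym O j a r i y : j < size r ->
  Exec O (pushsym j a) (Cfg r i y) tt (Cfg (upd r j (sbits a ++ get r j)) i y) 2.
Proof.
move=> jr; have -> : 2 = 1 + 1 by [].
eapply Exec_bind; first exact: Exec_push.
set r1 := upd r j (sbits a ++ _).
have -> : r1 = upd (upd r j (nth false (sbits a) 1 :: get r j)) j
   (nth false (sbits a) 0 :: get (upd r j (nth false (sbits a) 1 :: get r j)) j).
  by rewrite /r1 get_upd // eqxx upd_upd; case: (a).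
by apply: Exec_push; rewrite size_upd.
Qed.

Definition popsym j : pM (option sym) :=
  o <- pop j ;;
  if o is Some b then c <- pop j ;; ret (Some (sdec b (odflt false c))) else ret None.

Lemma Exec_popsym O j w r i y : j < size r -> get r j = encs w ->
  Exec O (popsym j) (Cfg r i y) (ohead w) (Cfg (upd r j (encs (behead w))) i y) 3.
Proof.
move=> jr e; have -> : 3 = 1 + 2 by [].
eapply Exec_bind; first exact: Exec_pop.
rewrite e; case: w e => [|a w] e.
  by apply: Exec_le; first exact: Exec_ret.
have -> : ohead (encs (a :: w)) = Some (nth false (sbits a) 0) by case: a {e}.
rewrite /=; have -> : 2 = 1 + 1 by [].
eapply Exec_bind; first by apply: Exec_pop; rewrite size_upd.
rewrite get_upd // eqxx upd_upd.
have -> : behead (behead (encs (a :: w))) = encs w by case: a {e}.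
have -> : Some a = Some (sdec (nth false (sbits a) 0) (odflt false (ohead (behead (encs (a :: w)))))).
  by case: a {e} => [|b|].
exact: Exec_ret.
Qed.

(** Pushing reverses: a register filled by [readx], which holds [rev x], is loaded as [x]. *)
Definition load j k t := forpop j (fun b => push t b ;;; pushsym k (Bit b)) ;;; mv t j.

Lemma Exec_load O j k t r i y : j < size r -> k < size r -> t < size r ->
  j <> k -> j <> t -> t <> k -> get r t = [::] ->
  Exec O (load j k t) (Cfg r i y) tt
    (Cfg (upd r k (encs (map Bit (rev (get r j))) ++ get r k)) i y) (8 * size (get r j) + 4).
Proof.
move=> jr kr tr jk jt tk e.
have aux a : forall r, j < size r -> k < size r -> t < size r -> get r j = a ->
  Exec O (forpop j (fun b => push t b ;;; pushsym k (Bit b))) (Cfg r i y) tt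
    (Cfg (upd (upd (upd r j [::]) t (rev a ++ get r t)) k
            (encs (map Bit (rev a)) ++ get r k)) i y) (5 * size a + 2).
  elim: a => [|b a IH] {jr kr tr e} {}r jr kr tr e.
    have e' := upd_get r j; rewrite e in e'; rewrite e' /= !upd_get; exact: Exec_forpop_nil.
  eapply Exec_le.
    eapply (Exec_forpop_cons jr e).
      eapply Exec_bind; first by apply: Exec_push; rewrite ?size_upd.
      by apply: Exec_pushsym; rewrite ?size_upd.
    set r1 := upd _ k _.
    have := IH r1; rewrite !size_upd => /(_ jr kr tr).
    have -> : get r1 j = a by rewrite /r1 !get_upd ?size_upd //; do !case: eqP => //.
    have -> : get r1 t = b :: get r t by rewrite /r1 !get_upd ?size_upd //; do !case: eqP => //; lia.
    have -> : get r1 k = sbits (Bit b) ++ get r k by rewrite /r1 !get_upd ?size_upd //; do !case: eqP => //; lia.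
    move=> /(_ erefl).
    set r2 := upd _ k _; set r3 := upd _ k _; suff -> : r2 = r3 by apply.
    rewrite /r2 /r3 /r1; reg_eq.
      by rewrite rev_cons map_rcons -cats1 encs_cat -catA.
    by rewrite rev_cons cat_rcons.
  by rewrite /=; lia.
eapply Exec_le.
  eapply Exec_bind; first exact: aux.
  set r1 := upd _ k _.
  have := @Exec_mv O t j r1 i y; rewrite !size_upd => /(_ tr jr (not_eq_sym jt)).
  have -> : get r1 t = rev (get r j).
    rewrite /r1 !get_upd ?size_upd // eqxx; case: eqP => // _; by rewrite e cats0.
  have -> : get r1 j = [::] by rewrite /r1 !get_upd ?size_upd // eqxx; do !case: eqP => //.
  rewrite revK cats0; set r2 := upd _ j _; set r3 := upd _ k _.
  have -> : r2 = r3 by rewrite /r2 /r3 /r1; reg_eq.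
  exact.
by rewrite size_rev; lia.
Qed.

(** Doubling and skipping share one pass so that [lookup] can address a block of the advice by
    Horner-like steps: one call per bit of the input, skipping [u] cells if the bit is set and
    passing from [u] to [2 * u]. *)
Definition dblskip (b : bool) j t :=
  forpop j (fun _ => (if b then read ;;; ret tt else ret tt) ;;; push t true ;;; push t true) ;;;
  mv t j.

Lemma behead_drop T n (s : seq T) : drop n (behead s) = drop n.+1 s.
Proof. by case: s. Qed.

Lemma Exec_dblskip O b j t r i y : j < size r -> t < size r -> j <> t -> get r t = [::] ->
  Exec O (dblskip b j t) (Cfg r i y) tt
    (Cfg (upd r j (nseq (2 * size (get r j)) true)) (if b then drop (size (get r j)) i else i) y)
    (12 * size (get r j) + 4).
Proof.
move=> jr tr jt e.
have aux a : forall r i, j < size r -> t < size r -> get r j = a ->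
  Exec O (forpop j (fun _ => (if b then read ;;; ret tt else ret tt) ;;; push t true ;;; push t true))
    (Cfg r i y) tt
    (Cfg (upd (upd r j [::]) t (nseq (2 * size a) true ++ get r t))
         (if b then drop (size a) i else i) y) (6 * size a + 2).
  elim: a => [|c a IH] {jr tr e} {}r {}i jr tr e.
    have e' := upd_get r j; rewrite e in e'; rewrite e' /= !upd_get drop0 if_same; exact: Exec_forpop_nil.
  eapply Exec_le.
    eapply (Exec_forpop_cons jr e).
      eapply Exec_bind.
        instantiate (1 := 2); instantiate (1 := Cfg (upd r j a) (if b then behead i else i) y).
        case: (b); last by apply: Exec_le; first exact: Exec_ret.
        have -> : 2 = 1 + 1 by []; eapply Exec_bind; [exact: Exec_read|exact: Exec_ret].
      by eapply Exec_bind; apply: Exec_push; rewrite ?size_upd.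
    set r1 := upd _ t _.
    have := IH r1; rewrite !size_upd => /(_ (if b then behead i else i) jr tr).
    have -> : get r1 j = a by rewrite /r1 !get_upd ?size_upd //; do !case: eqP => //.
    have -> : get r1 t = true :: true :: get r t by rewrite /r1 !get_upd ?size_upd // eqxx; case: eqP => //; lia.
    move=> /(_ erefl).
    set r2 := upd _ t _; set r3 := upd _ t _.
    have -> : r2 = r3.
      rewrite /r2 /r3 /r1; reg_eq.
      by rewrite !nseq_catS mulnS.
    have -> : (if b then drop (size a) (if b then behead i else i) else if b then behead i else i)
       = (if b then drop (size (c :: a)) i else i) by case: (b); rewrite ?behead_drop.
    exact.
  by rewrite /=; lia.
eapply Exec_le.
  eapply Exec_bind; first exact: aux.
  set r1 := upd _ t _; rewrite e cats0 in r1 *.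
  have := @Exec_mv O t j r1 (if b then drop (size (get r j)) i else i) y; rewrite !size_upd => /(_ tr jr (not_eq_sym jt)).
  have -> : get r1 t = nseq (2 * size (get r j)) true by rewrite /r1 !get_upd ?size_upd // eqxx.
  have -> : get r1 j = [::] by rewrite /r1 !get_upd ?size_upd // eqxx; do !case: eqP => //.
  rewrite cats0 rev_nseq; set r2 := upd _ j _; set r3 := upd _ j _.
  have -> : r2 = r3 by rewrite /r2 /r3 /r1; reg_eq.
  exact.
by rewrite size_nseq; lia.
Qed.

(** * Conversion from unary to binary; polynomials and powers in unary *)

Definition halve j t : pM bool :=
  b <- loop (fun _ : unit =>
     o <- pop j ;;
     if o is Some _ then
       o' <- pop j ;;
       if o' is Some _ then push t true ;;; ret (inl tt) else ret (inr true)
     else ret (inr false)) tt ;;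
  mv t j ;;; ret b.

Lemma Exec_halve O j t r i y : j < size r -> t < size r -> j <> t -> get r t = [::] ->
  Exec O (halve j t) (Cfg r i y) (odd (size (get r j)))
    (Cfg (upd r j (nseq (size (get r j))./2 true)) i y) (4 * size (get r j) + 6).
Proof.
move=> jr tr jt e.
have aux n : forall r, j < size r -> t < size r -> size (get r j) = n ->
  Exec O (loop (fun _ : unit =>
     o <- pop j ;;
     if o is Some _ then
       o' <- pop j ;;
       if o' is Some _ then push t true ;;; ret (inl tt) else ret (inr true)
     else ret (inr false)) tt)
    (Cfg r i y) (odd n)
    (Cfg (upd (upd r j [::]) t (nseq n./2 true ++ get r t)) i y) (2 * n + 2).
  elim/ltn_ind: n => n IH {jr tr e} {}r jr tr.
  case e: (get r j) => [|b [|c a]] /= en; subst n.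
  - apply: Exec_loop_stop; have -> : 2 * 0 + 2 = 1 + 1 by [].
    eapply Exec_bind; first exact: Exec_pop.
    rewrite e /=; have -> : upd (upd r j [::]) t (get r t) = upd r j [::] by reg_eq.
    exact: Exec_ret.
  - apply: Exec_loop_stop; apply: (@Exec_le _ _ _ _ _ _ (1 + (1 + 1))) => //.
    eapply Exec_bind; first exact: Exec_pop.
    rewrite e /=; eapply Exec_bind; first by apply: Exec_pop; rewrite size_upd.
    rewrite get_upd // eqxx upd_upd /=.
    have -> : upd (upd r j [::]) t (get r t) = upd r j [::] by reg_eq.
    exact: Exec_ret.
  - eapply Exec_le.
      eapply Exec_loop_next.
        eapply Exec_bind; first exact: Exec_pop.
        rewrite e /=; eapply Exec_bind; first by apply: Exec_pop; rewrite size_upd.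
        rewrite get_upd // eqxx upd_upd /=.
        eapply Exec_bind; first by apply: Exec_push; rewrite size_upd.
        exact: Exec_ret.
      set r1 := upd _ t _.
      have g1 : get r1 j = a by rewrite /r1 !get_upd ?size_upd // eqxx; case: eqP.
      have g2 : get r1 t = true :: get r t by rewrite /r1 !get_upd ?size_upd // eqxx; case: eqP => // ?; lia.
      have := @IH (size a) _ r1; rewrite !size_upd g1 g2 => /(_ _ jr tr erefl).
      set r2 := upd _ t _; set r3 := upd _ t _.
      have -> : r2 = r3.
        rewrite /r2 /r3 /r1 {g1 g2 r2 r3}; reg_eq.
        by rewrite nseq_catS.
      by rewrite [odd _.+2]/= negbK; apply; lia.
    lia.
eapply Exec_le.
  eapply Exec_bind; first exact: aux.
  rewrite e cats0; set r1 := upd _ t _.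
  eapply Exec_bind.
    have := @Exec_mv O t j r1 i y; rewrite !size_upd => /(_ tr jr (not_eq_sym jt)).
    have -> : get r1 t = nseq (size (get r j))./2 true by rewrite /r1 !get_upd ?size_upd // eqxx.
    have -> : get r1 j = [::] by rewrite /r1 !get_upd ?size_upd // eqxx; do !case: eqP => //.
    rewrite cats0 rev_nseq; set r2 := upd _ j _.
    have -> : r2 = upd r j (nseq (size (get r j))./2 true) by rewrite /r2 /r1; reg_eq.
    apply.
  exact: Exec_ret.
rewrite size_nseq; lia.
Qed.

(* Least significant bit first; [bits 0 = [:: false]]. *)
Fixpoint bits_rec (fuel n : nat) : seq bool :=
  odd n :: if n./2 is 0 then [::] else if fuel is f.+1 then bits_rec f n./2 else [::].
Definition bits n := bits_rec n n.

Lemma bitsE n : bits n = odd n :: if n./2 == 0 then [::] else bits n./2.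
Proof.
suff H f n' : n' <= f -> bits_rec f n' = bits_rec n' n'.
  rewrite /bits; case: n => [//|n] /=; congr (_ :: _).
  by case e: (uphalf n) => [//|k]; apply: H; lia.
elim/ltn_ind: f n' => f IH [|n'] h; first by case: f {IH h}.
case: f IH h => // f IH h /=; congr (_ :: _).
case e: (uphalf n') => [//|k].
rewrite IH; [|by lia|by lia].
by symmetry; apply: IH; lia.
Qed.

Lemma size_bits_gt0 n : 0 < size (bits n). Proof. by rewrite bitsE. Qed.

Lemma exp_size_bits n : 2 ^ size (bits n) <= 2 * n + 2.
Proof.
(* The bound [2 * n + 2] is not inductive, since its additive constant would double at each step. *)
suff : 2 ^ size (bits n) <= maxn 2 (2 * n) by lia.
elim/ltn_ind: n => n IH; rewrite bitsE /=.
case: eqP => [_|h]; first by rewrite expn1; lia.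
have l : n./2 < n by lia.
move: (IH _ l); rewrite expnS; lia.
Qed.

Lemma size_bits_exp n : size (bits (2 ^ n)) = n.+1.
Proof.
elim: n => [//|n IH]; rewrite bitsE expnS mul2n doubleK.
by rewrite (negPf (lt0n_neq0 _)) ?expn_gt0 //= IH.
Qed.

Lemma exp_size_bits_pred n : 2 ^ (size (bits n)).-1 <= n.+1.
Proof.
have := exp_size_bits n; have := size_bits_gt0 n.
by case: (size _) => // k _; rewrite expnS /=; lia.
Qed.

Definition tobin j k l t : pM unit :=
  loop (fun _ : unit =>
    b <- halve j t ;; push k b ;;;
    o <- pop j ;; if o is Some _ then push j true ;;; ret (inl tt) else ret (inr tt)) tt ;;;
  mv k l.

(** Each round halves the number, so the costs of the rounds form a geometric sum and the total
    stays linear. *)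
Lemma Exec_tobin O j k l t r i y :
  j < size r -> k < size r -> l < size r -> t < size r ->
  j <> k -> j <> l -> j <> t -> k <> l -> k <> t -> l <> t ->
  get r k = [::] -> get r l = [::] -> get r t = [::] ->
  Exec O (tobin j k l t) (Cfg r i y) tt
    (Cfg (upd (upd r j [::]) l (bits (size (get r j)))) i y) (30 * size (get r j) + 30).
Proof.
move=> jr kr lr tr jk jl jt kl kt lt ek el et.
have aux n : forall r, j < size r -> k < size r -> t < size r -> get r t = [::] ->
  size (get r j) = n ->
  Exec O (loop (fun _ : unit =>
    b <- halve j t ;; push k b ;;;
    o <- pop j ;; if o is Some _ then push j true ;;; ret (inl tt) else ret (inr tt)) tt)
    (Cfg r i y) tt
    (Cfg (upd (upd r j [::]) k (rev (bits n) ++ get r k)) i y) (20 * n + 9).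
  elim/ltn_ind: n => n IH {lr jr kr tr ek el et} {}r jr kr tr et en.
  have [h|h] := posnP n./2.
    apply: Exec_loop_stop; eapply Exec_le.
      eapply Exec_bind; first exact: Exec_halve.
      eapply Exec_bind; first by apply: Exec_push; rewrite size_upd.
      rewrite get_upd //; case: eqP => [|_]; first by lia.
      eapply Exec_bind; first by apply: Exec_pop; rewrite !size_upd.
      rewrite get_upd ?size_upd //; case: eqP => // _.
      rewrite get_upd // eqxx en h /=.
      rewrite bitsE h eqxx /=; set r1 := upd _ j _; set r2 := upd _ k _.
      have -> : r1 = r2 by rewrite /r1 /r2; reg_eq.
      exact: Exec_ret.
    lia.
  eapply Exec_le.
    eapply Exec_loop_next.
      eapply Exec_bind; first exact: Exec_halve.
      eapply Exec_bind; first by apply: Exec_push; rewrite size_upd.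
      rewrite get_upd //; case: eqP => [|_]; first by lia.
      eapply Exec_bind; first by apply: Exec_pop; rewrite !size_upd.
      rewrite get_upd ?size_upd //; case: eqP => // _.
      rewrite get_upd // eqxx en.
      have -> : ohead (nseq n./2 true) = Some true by case: (n./2) h.
      eapply Exec_bind; first by apply: Exec_push; rewrite !size_upd.
      exact: Exec_ret.
    set r1 := upd _ j _.
    have g1 : get r1 j = nseq n./2 true.
      by rewrite /r1; reg_get; case: (n./2) h.
    have g2 : get r1 k = odd n :: get r k.
      by rewrite /r1; reg_get.
    have g3 : get r1 t = [::].
      by rewrite /r1; reg_get.
    have := IH n./2 _ r1; rewrite !size_upd g1 g2 size_nseq => /(_ _ jr kr tr g3 erefl).
    set r2 := upd _ k _; set r3 := upd _ k _.
    have -> : r2 = r3.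
      rewrite /r2 /r3 /r1 {g1 g2 g3 r2 r3} (bitsE n); reg_eq.
      by rewrite rev_cons cat_rcons.
    by apply; lia.
  lia.
eapply Exec_le.
  eapply Exec_bind; first exact: aux.
  rewrite ek cats0; set r1 := upd _ k _.
  have := @Exec_mv O k l r1 i y; rewrite !size_upd => /(_ kr lr kl).
  have -> : get r1 k = rev (bits (size (get r j))) by rewrite /r1 !get_upd ?size_upd // eqxx.
  have -> : get r1 l = [::] by rewrite /r1; reg_get.
  rewrite cats0 revK; set r2 := upd _ l _; set r3 := upd _ l _.
  have -> : r2 = r3 by rewrite /r2 /r3 /r1; reg_eq.
  exact.
rewrite size_rev; have : size (bits (size (get r j))) <= 2 * size (get r j) + 2.
  by apply: leq_trans (exp_size_bits _); apply: ltnW; apply: ltn_expl.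
lia.
Qed.

Fixpoint rpt (n : nat) (m : pM unit) : pM unit := if n is n'.+1 then m ;;; rpt n' m else ret tt.

Lemma Exec_push_rpt O j n r i y : j < size r ->
  Exec O (rpt n (push j true)) (Cfg r i y) tt (Cfg (upd r j (nseq n true ++ get r j)) i y) n.+1.
Proof.
elim: n r => [|n IH] r jr /=; first by rewrite upd_get; exact: Exec_ret.
rewrite -[n.+2]add1n; eapply Exec_bind; first exact: Exec_push.
have := IH (upd r j (true :: get r j)); rewrite size_upd get_upd // eqxx upd_upd nseq_catS.
by apply.
Qed.

(* Horner's rule on unary numbers. *)
Fixpoint pevalp (p : seq nat) n u v t : pM unit :=
  if p is c :: p' then
    pevalp p' n u v t ;;; forpop u (fun _ => addu n v t) ;;; mv v u ;;; rpt c (push u true)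
  else ret tt.

Lemma peval_cons c p n : peval (c :: p) n = c + n * peval p n.
Proof.
rewrite /peval big_ord_recl /= muln1 big_distrr /=; congr (_ + _).
by apply: eq_bigr => i _; rewrite expnS mulnCA.
Qed.

Fixpoint pcost (p : seq nat) n : nat :=
  if p is c :: p' then pcost p' n + (peval p' n * (7 * n + 6) + 2) + (3 * (peval p' n * n) + 2) + c.+1
  else 1.

Lemma Exec_pevalp O p jn u v t r i y :
  jn < size r -> u < size r -> v < size r -> t < size r ->
  jn <> u -> jn <> v -> jn <> t -> u <> v -> u <> t -> v <> t ->
  get r u = [::] -> get r v = [::] -> get r t = [::] ->
  Exec O (pevalp p jn u v t) (Cfg r i y) tt
    (Cfg (upd r u (nseq (peval p (size (get r jn))) true)) i y) (pcost p (size (get r jn))).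
Proof.
move=> nr ur vr tr nu nv nt uv ut vt eu ev et.
set n := size (get r jn).
have aux m : forall z, Exec O (forpop u (fun _ => addu jn v t))
    (Cfg (upd (upd r u (nseq m true)) v (nseq z true)) i y) tt
    (Cfg (upd (upd r u [::]) v (nseq (m * n + z) true)) i y) (m * (7 * n + 6) + 2).
  elim: m => [|m IHm] z.
    by rewrite mul0n !add0n; apply: Exec_forpop_nil; rewrite ?size_upd //; by reg_get.
  eapply Exec_le.
    eapply (@Exec_forpop_cons _ _ _ _ _ _ true (nseq m true)); rewrite ?size_upd //.
    - by reg_get.
    - apply: (@Exec_addu _ jn v t); rewrite ?size_upd //; try lia.
      by reg_get.
    set r1 := upd _ v _.
    have -> : r1 = upd (upd r u (nseq m true)) v (nseq (z + n) true).
      rewrite /r1; reg_eq.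
      by rewrite addnC nseqD.
    by have := IHm (z + n); rewrite (mulSn m n) [n + m * n]addnC -addnA [n + z]addnC; exact.
  reg_get; rewrite -/n; lia.
elim: p => [|c p IH]; first by rewrite /peval big_ord0 /= -eu upd_get; exact: Exec_ret.
rewrite -/n in IH *.
eapply Exec_le => /=.
  eapply Exec_bind; first exact: IH.
  have e0 : upd r u (nseq (peval p n) true)
      = upd (upd r u (nseq (peval p n) true)) v (nseq 0 true) by reg_eq.
  eapply Exec_bind; first by rewrite e0; exact: aux.
  rewrite addn0.
  eapply Exec_bind.
    apply: Exec_mv; rewrite ?size_upd //; lia.
  set r1 := upd _ u _.
  have -> : r1 = upd r u (nseq (peval p n * n) true).
    rewrite /r1; reg_eq.
    reg_get.
    by rewrite cats0 rev_nseq.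
  have := @Exec_push_rpt O u c (upd r u (nseq (peval p n * n) true)) i y.
  rewrite size_upd get_upd // eqxx upd_upd -nseqD => /(_ ur).
  rewrite peval_cons [n * _]mulnC; exact.
rewrite !get_upd ?size_upd // eqxx size_nseq; lia.
Qed.

Definition pow2 k jn u t : pM unit :=
  push u true ;;; forpop jn (fun _ => rpt k (dblskip false u t)) ;;; rpt k (dblskip false u t).

Lemma Exec_rpt_dbl O k u t r m i y : u < size r -> t < size r -> u <> t -> get r t = [::] ->
  Exec O (rpt k (dblskip false u t)) (Cfg (upd r u (nseq m true)) i y) tt
    (Cfg (upd r u (nseq (2 ^ k * m) true)) i y) (k * (12 * (2 ^ k * m) + 4) + 1).
Proof.
move=> ur tr ut et; elim: k m => [|k IH] m; first by rewrite /= !mul1n; exact: Exec_ret.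
eapply Exec_le => /=.
  eapply Exec_bind.
    apply: Exec_dblskip; rewrite ?size_upd //; by reg_get.
  rewrite get_upd // eqxx size_nseq upd_upd.
  have := IH (2 * m); rewrite mulnA -expnSr; exact.
rewrite get_upd // eqxx size_nseq mulSn.
have : m <= 2 ^ k.+1 * m by apply: leq_pmull; rewrite expn_gt0.
lia.
Qed.

Lemma Exec_pow2 O k jn u t r i y : jn < size r -> u < size r -> t < size r ->
  jn <> u -> jn <> t -> u <> t -> get r u = [::] -> get r t = [::] ->
  let n := size (get r jn) in
  Exec O (pow2 k jn u t) (Cfg r i y) tt
    (Cfg (upd (upd r jn [::]) u (nseq (expb k n) true)) i y)
    ((n + 1) * (k * (12 * expb k n + 4) + 3) + 3).
Proof.
move=> nr ur tr nu nt ut eu et n.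
have aux a : forall r m, jn < size r -> u < size r -> t < size r -> get r jn = a -> get r t = [::] ->
  Exec O (forpop jn (fun _ => rpt k (dblskip false u t))) (Cfg (upd r u (nseq m true)) i y) tt
    (Cfg (upd (upd r jn [::]) u (nseq (2 ^ (k * size a) * m) true)) i y)
    (size a * (k * (12 * (2 ^ (k * size a) * m) + 4) + 3) + 2).
  elim: a => [|b a IH] {nr ur tr eu et n} {}r m nr ur tr en et.
    rewrite muln0 mul1n; have -> : upd r jn [::] = r by rewrite -{2}(upd_get r jn) en.
    by apply: Exec_forpop_nil; rewrite ?size_upd //; reg_get.
  eapply Exec_le.
    eapply (@Exec_forpop_cons _ _ _ _ _ _ b a); rewrite ?size_upd //.
    - by reg_get.
    - have -> : upd (upd r u (nseq m true)) jn a = upd (upd r jn a) u (nseq m true) by reg_eq.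
      by apply: Exec_rpt_dbl; rewrite ?size_upd //; reg_get.
    have := IH (upd r jn a) (2 ^ k * m); rewrite !size_upd get_upd // eqxx => /(_ nr ur tr erefl).
    rewrite get_upd // et; case: eqP => [|_]; first by lia.
    rewrite upd_upd mulnA -expnD; have -> : k * size a + k = k * size (b :: a) by rewrite /=; lia.
    by move=> /(_ erefl); exact.
  rewrite [size (b :: a)]/= (mulSn (size a)).
  have : 2 ^ k * m <= 2 ^ (k * (size a).+1) * m.
    by rewrite leq_mul // leq_exp2l //; lia.
  move: (2 ^ (k * (size a).+1) * m) (2 ^ k * m) => z2 z1 hz.
  have : k * (12 * z1 + 4) <= k * (12 * z2 + 4) by rewrite leq_mul //; lia.
  lia.
eapply Exec_le.
  eapply Exec_bind; first exact: Exec_push.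
  rewrite eu -[[:: true]]/(nseq 1 true).
  eapply Exec_bind; first exact: aux.
  rewrite muln1 -/n.
  have := @Exec_rpt_dbl O k u t (upd r jn [::]) (2 ^ (k * n)) i y.
  rewrite !size_upd => /(_ ur tr ut); rewrite -expnD [k + _]addnC.
  by rewrite get_upd // et if_same => /(_ erefl); exact.
rewrite -/n muln1 -/(expb k n).
have : 2 ^ (k * n) <= expb k n by rewrite /expb leq_exp2l //; lia.
move: (2 ^ _) (expb _ _) => z1 z2 hz.
have : n * (k * (12 * z1 + 4) + 3) <= n * (k * (12 * z2 + 4) + 3).
  by rewrite leq_mul // leq_add2r leq_mul //; lia.
by rewrite mulnDl mul1n; lia.
Qed.

Definition is_bit (a : sym) := if a is Bit _ then true else false.
Definition bit_of (a : sym) := if a is Bit b then b else false.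

Definition readx j : pM sym :=
  loop (fun _ : unit => s <- read ;;
    if s is Bit b then push j b ;;; ret (inl tt) else ret (inr s)) tt.

Lemma Exec_readx O j x i r y : j < size r -> ~~ is_bit (head Blank i) ->
  Exec O (readx j) (Cfg r (map Bit x ++ i) y) (head Blank i)
    (Cfg (upd r j (rev x ++ get r j)) (behead i) y) (3 * size x + 2).
Proof.
elim: x r => [|b x IH] r jr hi.
  rewrite /= upd_get; apply: Exec_loop_stop; apply: (@Exec_le _ _ _ _ _ _ (1 + 1)) => //.
  eapply Exec_bind; first exact: Exec_read.
  by case: (head Blank i) hi => // *; exact: Exec_ret.
eapply Exec_le.
  eapply Exec_loop_next.
    eapply Exec_bind; first exact: Exec_read.
    rewrite /=; eapply Exec_bind; [exact: Exec_push|exact: Exec_ret].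
  have := IH (upd r j (b :: get r j)); rewrite size_upd get_upd // eqxx upd_upd => /(_ jr hi).
  by rewrite rev_cons cat_rcons; exact.
by rewrite /=; lia.
Qed.

(** Total on purpose: separators and cells past the end read as [false], so malformed or short
    advice yields a block as well. *)
Definition blk n (i : seq sym) := mkseq (fun k => bit_of (nth Blank i k)) n.

(** Two copies are made because a simulation consumes its choice bits, and [lookup] runs two
    machines on the same block. *)
Definition readblk w g z := forpop w (fun _ => s <- read ;; push g (bit_of s) ;;; push z (bit_of s)).

Lemma Exec_readblk O w g z r i y : w < size r -> g < size r -> z < size r ->
  w <> g -> w <> z -> g <> z ->
  let b := blk (size (get r w)) i in
  Exec O (readblk w g z) (Cfg r i y) tt
    (Cfg (upd (upd (upd r w [::]) g (rev b ++ get r g)) z (rev b ++ get r z))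
       (drop (size (get r w)) i) y) (5 * size (get r w) + 2).
Proof.
move=> wr gr zr wg wz gz; rewrite /=; move e: (get r w) => a.
elim: a r i wr gr zr e => [|b a IH] r i wr gr zr e.
  have e' := upd_get r w; rewrite e in e'; rewrite e' /blk /= !upd_get drop0; exact: Exec_forpop_nil.
eapply Exec_le.
  eapply (Exec_forpop_cons wr e).
    eapply Exec_bind; first exact: Exec_read.
    by eapply Exec_bind; apply: Exec_push; rewrite ?size_upd.
  set r1 := upd _ z _.
  have := IH r1 (behead i); rewrite !size_upd => /(_ wr gr zr).
  have -> : get r1 w = a by rewrite /r1; reg_get.
  have -> : get r1 g = bit_of (head Blank i) :: get r g by rewrite /r1; reg_get.
  have -> : get r1 z = bit_of (head Blank i) :: get r z by rewrite /r1; reg_get.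
  move=> /(_ erefl); rewrite behead_drop.
  set r2 := upd _ z _; set r3 := upd _ z _; suff -> : r2 = r3 by apply.
  have eb s : rev (blk (size (b :: a)) i) ++ s = rev (blk (size a) (behead i)) ++ bit_of (head Blank i) :: s.
    have -> : blk (size (b :: a)) i = bit_of (head Blank i) :: blk (size a) (behead i).
      rewrite /blk /mkseq /= -[1]addn0 iotaDl -map_comp; case: (i) => [|c i'] //=.
      by congr (_ :: _); apply: eq_map => k /=; rewrite !nth_nil.
    by rewrite rev_cons cat_rcons.
  by rewrite /r2 /r3 /r1 {r2 r3 r1} !eb; reg_eq.
by rewrite /=; lia.
Qed.

(** * Simulation of a machine: tapes in registers 0 to 3, choice bits in register 4 *)

Definition putmove l k a (m : move) : pM unit :=
  match m with
  | MoveL => o <- popsym l ;; pushsym k a ;;; (if o is Some b then pushsym k b else ret tt)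
  | MoveR => pushsym l a
  | Stay => pushsym k a
  end.

Lemma Exec_putmove O l k a m t r i y : l < size r -> k < size r -> l <> k ->
  get r l = encs (tl t) -> get r k = encs (behead (tr t)) ->
  let t' := move_tape m (write_sym t a) in
  Exec O (putmove l k a m) (Cfg r i y) tt
    (Cfg (upd (upd r l (encs (tl t'))) k (encs (tr t'))) i y) 7.
Proof.
move=> lr kr lk el ek; have el' := upd_get r l; have ek' := upd_get r k.
rewrite ?el ?ek in el' ek'; case: m => /=.
- eapply Exec_le.
    eapply Exec_bind; first exact: (@Exec_popsym _ _ (tl t)).
    eapply Exec_bind; first by apply: Exec_pushsym; rewrite size_upd.
    rewrite get_upd //; case: eqP => [?|_]; first by lia.
    rewrite ek; case etl: (tl t) => [|b s] /=.
      by rewrite etl; apply: (@Exec_le _ _ _ _ _ _ 1 2) => //; exact: Exec_ret.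
    set r2 := upd _ k (encs _).
    suff -> : r2 = upd (upd (upd r l (encs s)) k (sbits a ++ encs (behead (tr t)))) k
      (sbits b ++ get (upd (upd r l (encs s)) k (sbits a ++ encs (behead (tr t)))) k).
      by apply: Exec_pushsym; rewrite !size_upd.
    by rewrite /r2 get_upd ?size_upd // eqxx upd_upd.
  by [].
- set r2 := upd _ k _; have -> : r2 = upd r l (sbits a ++ get r l) by rewrite /r2; reg_eq; rewrite el.
  by eapply Exec_le; first exact: Exec_pushsym.
- set r2 := upd _ k _; have -> : r2 = upd r k (sbits a ++ get r k) by rewrite /r2; reg_eq; rewrite ek.
  by eapply Exec_le; first exact: Exec_pushsym.
Qed.

Definition unpop k (o : option sym) : pM unit := if o is Some a then pushsym k a else ret tt.

Lemma Exec_unpop O k w r i y : k < size r -> get r k = encs (behead w) ->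
  Exec O (unpop k (ohead w)) (Cfg r i y) tt (Cfg (upd r k (encs w)) i y) 2.
Proof.
move=> kr e; case: w e => [|a w] /= e.
  have ee := upd_get r k; rewrite e in ee; rewrite ee.
  by apply: (@Exec_le _ _ _ _ _ _ 1 2) => //; exact: Exec_ret.
by have := @Exec_pushsym O k a r i y kr; rewrite e.
Qed.

Section Sim.
Variable M : TM.

(** Only runs without oracle are simulated, so a query continues in [qn], the state for a negative
    answer. Exhausted registers supply blanks and [false] bits. *)
Definition sim_step (q : state M) : pM (state M + option bool) :=
  a <- popsym 1 ;; b <- popsym 3 ;; c <- pop 4 ;;
  match delta q (odflt Blank a) (odflt Blank b) (odflt false c) with
  | Halt o => ret (inr o)
  | Step q' a1 m1 a2 m2 => putmove 0 1 a1 m1 ;;; putmove 2 3 a2 m2 ;;; ret (inl q')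
  | Query qy qn => unpop 1 a ;;; unpop 3 b ;;; ret (inl qn)
  end.

Definition simregs (t1 t2 : tape) cs R :=
  [:: encs (tl t1), encs (tr t1), encs (tl t2), encs (tr t2), cs & R].

Definition tsize (t : tape) := size (tl t) + size (tr t).

Lemma tsize_move m t a : tsize (move_tape m (write_sym t a)) <= (tsize t).+1.
Proof. by rewrite /tsize; case: m; case: t => [[|b l] [|c r]] /=; lia. Qed.

Lemma head_odflt t : odflt Blank (ohead (tr t)) = head_sym t.
Proof. by case: t => l [|a r]. Qed.

(** A simulated step costs at most 3 + 3 + 1 operations for the pops and 7 + 7 + 1 for writing,
    moving and returning, hence the factor 22. The size bounds on the tapes pay for clearing them
    afterwards. *)
Lemma Exec_sim O T i0 q t1 t2 c cs o R i y :
  run (M := M) no_oracle c T i0 q t1 t2 = Some o -> (forall j, c (i0 + j) = nth false cs j) ->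
  exists t1' t2' cs',
    Exec O (loop sim_step q) (Cfg (simregs t1 t2 cs R) i y) o (Cfg (simregs t1' t2' cs' R) i y) (22 * T)
    /\ [/\ tsize t1' <= tsize t1 + T, tsize t2' <= tsize t2 + T & size cs' <= size cs].
Proof.
elim: T i0 q t1 t2 cs => // T IH i0 q t1 t2 cs /= + hc.
have hd : odflt false (ohead cs) = c i0 by have := hc 0; rewrite addn0 => ->; case: (cs).
have hc' j : c (i0.+1 + j) = nth false (behead cs) j.
  by rewrite addSnnS hc; case: (cs) => //=; case: (j).
pose R0 := [:: encs (tl t1); encs (behead (tr t1)); encs (tl t2); encs (behead (tr t2)); behead cs] ++ R.
have pops : Exec O (popsym 1) (Cfg (simregs t1 t2 cs R) i y) (ohead (tr t1))
   (Cfg (upd (simregs t1 t2 cs R) 1 (encs (behead (tr t1)))) i y) 3 by exact: Exec_popsym.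
have pops2 : Exec O (popsym 3) (Cfg (upd (simregs t1 t2 cs R) 1 (encs (behead (tr t1)))) i y) (ohead (tr t2))
   (Cfg [:: encs (tl t1), encs (behead (tr t1)), encs (tl t2), encs (behead (tr t2)), cs & R] i y) 3.
  exact: Exec_popsym.
have pops3 : Exec O (pop 4) (Cfg [:: encs (tl t1), encs (behead (tr t1)), encs (tl t2), encs (behead (tr t2)), cs & R] i y) (ohead cs) (Cfg R0 i y) 1.
  exact: Exec_pop.
case ed: (delta q (head_sym t1) (head_sym t2) (c i0)) => [o'|q' a1 m1 a2 m2|qy qn] hr.
- case: hr => <-; exists (Tape (tl t1) (behead (tr t1))), (Tape (tl t2) (behead (tr t2))), (behead cs).
  split; last by rewrite /tsize /= !size_behead; split; lia.
  eapply Exec_le; first eapply Exec_loop_stop.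
    eapply Exec_bind; first exact: pops.
    eapply Exec_bind; first exact: pops2.
    eapply Exec_bind; first exact: pops3.
    by rewrite !head_odflt hd ed; exact: Exec_ret.
  by lia.
- have [t1' [t2' [cs' [h [s1 s2 s3]]]]] := IH _ _ _ _ _ hr hc'.
  exists t1', t2', cs'; split.
    eapply Exec_le; first eapply Exec_loop_next; [|exact: h|].
      eapply Exec_bind; first exact: pops.
      eapply Exec_bind; first exact: pops2.
      eapply Exec_bind; first exact: pops3.
      rewrite !head_odflt hd ed.
      eapply Exec_bind; first exact: (@Exec_putmove _ 0 1 a1 m1 t1).
      eapply Exec_bind; first exact: (@Exec_putmove _ 2 3 a2 m2 t2).
      exact: Exec_ret.
    by lia.
  have := tsize_move m1 t1 a1; have := tsize_move m2 t2 a2; rewrite size_behead in s3; split; lia.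
- have [t1' [t2' [cs' [h [s1 s2 s3]]]]] := IH _ _ _ _ _ hr hc'.
  exists t1', t2', cs'; split.
    eapply Exec_le; first eapply Exec_loop_next; [|exact: h|].
      eapply Exec_bind; first exact: pops.
      eapply Exec_bind; first exact: pops2.
      eapply Exec_bind; first exact: pops3.
      rewrite !head_odflt hd ed.
      eapply Exec_bind; first exact: (@Exec_unpop _ 1 (tr t1)).
      eapply Exec_bind; first exact: (@Exec_unpop _ 3 (tr t2)).
      exact: Exec_ret.
    by lia.
  rewrite size_behead in s3; split; lia.
Qed.

(** The working registers are emptied so that another simulation can follow, as in [zpp_round] and
    [lookup]. *)
Definition simc : pM (option bool) :=
  o <- loop sim_step (start M) ;;
  clear 0 ;;; clear 1 ;;; clear 2 ;;; clear 3 ;;; clear 4 ;;; ret o.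

Lemma Exec_simc O T w cs o R i y : result M no_oracle (nth false cs) w T = Some o ->
  Exec O simc (Cfg [:: [::], encs w, [::], [::], cs & R] i y) o
    (Cfg [:: [::], [::], [::], [::], [::] & R] i y) (40 * T + 6 * size w + 3 * size cs + 11).
Proof.
move=> /(@Exec_sim O _ _ _ _ _ _ cs _ R i y) [//|t1' [t2' [cs' [h [s1 s2 s3]]]]].
eapply Exec_le.
  eapply Exec_bind; first exact: h.
  eapply Exec_bind; first exact: Exec_clear.
  eapply Exec_bind; first exact: Exec_clear.
  eapply Exec_bind; first exact: Exec_clear.
  eapply Exec_bind; first exact: Exec_clear.
  eapply Exec_bind; first exact: Exec_clear.
  exact: Exec_ret.
rewrite /= !size_encs; move: s1 s2; rewrite /tsize /=; lia.
Qed.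
End Sim.

(** * Polynomial and exponential bounds *)

Definition pb (f : nat -> nat) := exists k, forall n, f n <= polyb k n.
Definition eb (f : nat -> nat) := exists k, forall n, f n <= expb k n.

(** Powers of [n + 2] are easier to combine than [polyb]: the base is at least 2 everywhere, so they
    grow with the exponent, multiply by adding exponents and absorb a factor 2. *)
Lemma pb_intro f k : (forall n, f n <= (n + 2) ^ k) -> pb f.
Proof.
(* For [n >= 2] one has [n + 2 <= n ^ 2], which explains [2 * k]; for [n <= 1] the summand [3 ^ k]
   of the additive constant suffices. *)
move=> h; exists (2 * k + 3 ^ k) => n; apply: leq_trans (h n) _; rewrite /polyb.
have [n1|n2] := leqP n 1.
  apply: leq_trans (_ : 3 ^ k <= _); last by rewrite -addnA addnCA; lia.
  by case: k {h} => // k; rewrite leq_exp2r; lia.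
apply: leq_trans (_ : n ^ (2 * k) <= _).
  rewrite expnM; case: k {h} => // k; rewrite leq_exp2r // expnS expn1.
  by apply: leq_trans (_ : 2 * n <= _); [lia|rewrite leq_mul].
by apply: leq_trans (leq_addr _ _); rewrite leq_pexp2l //; lia.
Qed.

Lemma pb_elim f : pb f -> exists k, forall n, f n <= (n + 2) ^ k.
Proof.
case=> k h; exists (2 * k + 1) => n; apply: leq_trans (h n) _; rewrite /polyb.
have h1 : n ^ k <= (n + 2) ^ k by case: k {h} => // k; rewrite leq_exp2r; lia.
have h2 : k <= (n + 2) ^ k.
  by apply: leq_trans (_ : 2 ^ k <= _); [exact: ltnW (ltn_expl _ _)|case: k {h h1} => // k; rewrite leq_exp2r; lia].
apply: leq_trans (_ : 2 * (n + 2) ^ k <= _); first by lia.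
rewrite addn1 expnS leq_mul //; first by lia.
by rewrite leq_pexp2l //; lia.
Qed.

Lemma pb_le f g : (forall n, f n <= g n) -> pb g -> pb f.
Proof. by move=> h [k hk]; exists k => n; apply: leq_trans (h n) (hk n). Qed.

Lemma pb_mul f g : pb f -> pb g -> pb (fun n => f n * g n).
Proof.
move=> /pb_elim[a ha] /pb_elim[b hb]; apply: (@pb_intro _ (a + b)) => n.
by rewrite expnD leq_mul.
Qed.

Lemma pb_add f g : pb f -> pb g -> pb (fun n => f n + g n).
Proof.
move=> /pb_elim[a ha] /pb_elim[b hb]; apply: (@pb_intro _ (a + b).+1) => n.
rewrite expnS; have := ha n; have := hb n.
have : (n + 2) ^ a <= (n + 2) ^ (a + b) by rewrite leq_pexp2l //; lia.
have : (n + 2) ^ b <= (n + 2) ^ (a + b) by rewrite leq_pexp2l //; lia.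
have : 2 * (n + 2) ^ (a + b) <= (n + 2) * (n + 2) ^ (a + b) by rewrite leq_mul //; lia.
lia.
Qed.

Lemma pb_const c : pb (fun _ => c).
Proof.
exists (c + 2) => n; rewrite /polyb; lia.
Qed.

Lemma pb_id : pb (fun n => n).
Proof. by exists 1 => n; rewrite /polyb expn1; lia. Qed.

Lemma pb_succ f : pb f -> pb (fun n => (f n).+1).
Proof.
move=> h; apply: pb_le (pb_add h (pb_const 1)) => n; lia.
Qed.

Lemma pb_polyb k : pb (polyb k). Proof. by exists k. Qed.

Lemma pb_exp f k : pb f -> pb (fun n => f n ^ k).
Proof.
move=> h; elim: k => [|k IH]; first by apply: pb_le (pb_const 1) => n.
by apply: pb_le (pb_mul h IH) => n; rewrite expnS.
Qed.

Lemma pb_peval p : pb (peval p).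
Proof.
elim: p => [|c p IH].
  by apply: pb_le (pb_const 0) => n; rewrite /peval big_ord0.
apply: pb_le (pb_add (pb_const c) (pb_mul pb_id IH)) => n; by rewrite peval_cons.
Qed.

Ltac pbnd := cbv beta; first
  [ assumption | exact: pb_const | exact: pb_id | exact: pb_polyb | exact: pb_peval
  | apply: pb_add; pbnd | apply: pb_mul; pbnd | apply: pb_succ; pbnd | apply: pb_exp; pbnd ].

Lemma pb_pcost p : pb (pcost p).
Proof. elim: p => [|c p IH] /=; last have hp := pb_peval p; pbnd. Qed.

Lemma eb_mul f g : eb f -> eb g -> eb (fun n => f n * g n).
Proof.
move=> [a ha] [b hb]; exists (a + b) => n.
apply: leq_trans (leq_mul (ha n) (hb n)) _.
by rewrite /expb -expnD leq_exp2l //; lia.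
Qed.

Lemma eb_le f g : (forall n, f n <= g n) -> eb g -> eb f.
Proof. by move=> h [k hk]; exists k => n; apply: leq_trans (h n) (hk n). Qed.

Lemma eb_add f g : eb f -> eb g -> eb (fun n => f n + g n).
Proof.
move=> [a ha] [b hb]; exists (a + b).+1 => n.
have := ha n; have := hb n; rewrite /expb.
have : 2 ^ (a * n + a) <= 2 ^ ((a + b) * n + (a + b)) by rewrite leq_exp2l //; lia.
have : 2 ^ (b * n + b) <= 2 ^ ((a + b) * n + (a + b)) by rewrite leq_exp2l //; lia.
have : 2 * 2 ^ ((a + b) * n + (a + b)) <= 2 ^ ((a + b).+1 * n + (a + b).+1).
  by rewrite -expnS leq_exp2l //; lia.
lia.
Qed.

Lemma eb_const c : eb (fun _ => c).
Proof.
exists c => n; apply: leq_trans (ltnW (ltn_expl c (leqnn 2))) _.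
by rewrite /expb leq_exp2l //; lia.
Qed.

Lemma eb_id : eb (fun n => n).
Proof.
exists 1 => n; apply: leq_trans (ltnW (ltn_expl n (leqnn 2))) _.
by rewrite /expb leq_exp2l //; lia.
Qed.

Lemma eb_succ f : eb f -> eb (fun n => (f n).+1).
Proof. move=> h; apply: eb_le (eb_add h (eb_const 1)) => n; lia. Qed.

Lemma eb_expb k : eb (expb k). Proof. by exists k. Qed.

Lemma eb_exp2 : eb (fun n => 2 ^ n).
Proof. by exists 1 => n; rewrite /expb leq_exp2l //; lia. Qed.

Ltac ebnd := cbv beta; first
  [ assumption | exact: eb_const | exact: eb_id | exact: eb_expb | exact: eb_exp2
  | apply: eb_add; ebnd | apply: eb_mul; ebnd | apply: eb_succ; ebnd ].

Lemma pb_time t : pb t -> exists k, forall n, 8 * t n * t n < polyb k n.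
Proof.
move=> h; have [k hk] : pb (fun n => (8 * t n * t n).+1) by pbnd.
by exists k.
Qed.

Lemma eb_time t : eb t -> exists k, forall n, 8 * t n * t n < expb k n.
Proof.
move=> h; have [k hk] : eb (fun n => (8 * t n * t n).+1) by ebnd.
by exists k.
Qed.

(** * Simulation on the input stored (reversed) in registers 5 and 6 *)

Section SimX.
Variable M : TM.

Definition simx := load 5 1 6 ;;; simc M.

Lemma Exec_simx O T x cs o R i y : result M no_oracle (nth false cs) (enc x) T = Some o ->
  Exec O simx (Cfg [:: [::], [::], [::], [::], cs, rev x, [::] & R] i y) o
    (Cfg [:: [::], [::], [::], [::], [::], rev x, [::] & R] i y)
    (40 * T + 14 * size x + 3 * size cs + 15).
Proof.
move=> h; eapply Exec_le.
  xstep Exec_load.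
  rewrite revK cats0; exact: Exec_simc h.
rewrite size_rev size_map; lia.
Qed.

Definition simxy := load 6 1 7 ;;; pushsym 1 Sep ;;; load 5 1 7 ;;; simc M.

Lemma Exec_simxy O T x z o R i y : result M no_oracle det_choices (encp x z) T = Some o ->
  Exec O simxy (Cfg [:: [::], [::], [::], [::], [::], rev x, rev z, [::] & R] i y) o
    (Cfg [:: [::], [::], [::], [::], [::], rev x, rev z, [::] & R] i y)
    (40 * T + 14 * size x + 14 * size z + 30).
Proof.
have -> : result M no_oracle det_choices (encp x z) T = result M no_oracle (nth false [::]) (encp x z) T.
  by apply: result_ext => j _; rewrite nth_nil.
move=> h; eapply Exec_le.
  xstep Exec_load.
  xstep Exec_pushsym.
  xstep Exec_load.
  rewrite !revK cats0.
  move: (@Exec_simc M O T _ _ _ [:: rev x, rev z, [::] & R] i y h).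
  rewrite {1}/encp encs_cat; exact.
rewrite !size_rev /encp size_cat /= !size_map; lia.
Qed.
End SimX.

(** * P is contained in YP *)

Definition ign_prog (M : TM) := boot 11 (readx 5 ;;; simx M).

Lemma P_YP L : P L -> YP L.
Proof.
case=> k [M hM].
have ht : pb (fun n => 11 + (3 * n + 2 + (40 * polyb k n + 14 * n + 15))) by pbnd.
have [k' hk'] := pb_time ht.
have main x y : result (toTM (ign_prog M)) no_oracle det_choices (encp x y) (polyb k' (size x))
    = Some (Some (L x)).
  rewrite result_det; have := hk' (size x).
  apply: resultL_Exec.
  apply: Exec_boot; eapply Exec_le => /=.
    eapply Exec_bind; first exact: Exec_readx.
    rewrite /= cats0; apply: (@Exec_simx _ _ (polyb k (size x)) _ [::]).
    by rewrite -hM; apply: result_ext => j _; rewrite nth_nil.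
  by rewrite /=; lia.
exists [::], k', (toTM (ign_prog M)); split=> [n|x y]; last by left.
by exists [::]; split=> [|x <-]; rewrite ?main // /peval big_ord0.
Qed.

(** * ZPP is contained in YP *)

(** The degree [k.+1] keeps the leading coefficient apart from the constant term even for [k = 0];
    [leq_polyb] absorbs the shift. *)
Definition polyb_list k := k.+1 :: rcons (nseq k 0) 1.

Lemma peval_polyb k n : peval (polyb_list k) n = polyb k.+1 n.
Proof.
rewrite /polyb_list peval_cons /polyb addnC expnS; congr (_ * _ + _).
elim: k => [|k IH] /=; first by rewrite peval_cons /peval big_ord0 muln0.
by rewrite peval_cons add0n IH expnS.
Qed.

Lemma leq_polyb k n : polyb k n <= polyb k.+1 n.
Proof.
rewrite /polyb; case: n => [|n]; first by case: k => //= k; rewrite !exp0n.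
rewrite leq_add // leq_pexp2l //.
Qed.

Section ZPPProg.
Variables (M : TM) (p : seq nat).

(** Register 9 counts the remaining rounds and register 7 holds the block length in unary; its copy
    in register 10 is used up by reading one block into register 4 as random bits. *)
Definition zpp_round (_ : unit) : pM (unit + option bool) :=
  o <- pop 9 ;;
  if o is Some _ then
    addu 7 10 6 ;;; readblk 10 4 11 ;;; clear 11 ;;; r <- simx M ;;
    (if r is Some b then ret (inr (Some b)) else ret (inl tt))
  else ret (inr None).

Definition zpp_prog := boot 11 (
  readx 5 ;;; addu 5 9 6 ;;; push 9 true ;;; addu 5 8 6 ;;; pevalp p 8 7 10 6 ;;;
  loop zpp_round tt).

Variables (L : lang) (x : seq bool).
Let n := size x.
Let T := peval p n.
Hypothesis hM : forall c, result M no_oracle c (enc x) T = Some (Some (L x)) \/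
                          result M no_oracle c (enc x) T = Some None.

(** The loop stops at the first block with a definite answer. Since every definite answer is
    correct, one useful block anywhere among the [m] is enough. *)
Lemma Exec_zpp_loop m i y :
  exists o s',
    [/\ Exec no_oracle (loop zpp_round tt)
      (Cfg [:: [::]; [::]; [::]; [::]; [::]; rev x; [::]; nseq T true; nseq n true; nseq m true; [::]; [::]] i y)
      o s' (m * (60 * T + 14 * n + 40) + 2),
      o = Some (L x) \/ o = None &
      forall j, j < m ->
        result M no_oracle (nth false (rev (blk T (drop (j * T) i)))) (enc x) T = Some (Some (L x)) ->
        o = Some (L x)].
Proof.
elim: m i => [|m IH] i.
  exists None; eexists; split=> //; last by right.
  apply: Exec_loop_stop; apply: (@Exec_le _ _ _ _ _ _ (1 + 1)) => //.
  by xstep Exec_pop; exact: Exec_ret.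
set cs := rev (blk T i).
have [r hr] : exists r, result M no_oracle (nth false cs) (enc x) T = Some r.
  by case: (hM (nth false cs)) => ->; eexists.
have hr2 : r = Some (L x) \/ r = None by case: (hM (nth false cs)); rewrite hr => -[->]; auto.
have body f s' t' : Exec no_oracle (if r is Some b then ret (inr (Some b)) else ret (inl tt) : pM (unit + option bool))
    (Cfg [:: [::]; [::]; [::]; [::]; [::]; rev x; [::]; nseq T true; nseq n true; nseq m true; [::]; [::]] (drop T i) y)
    f s' t' -> t' <= 1 ->
    Exec no_oracle (zpp_round tt)
    (Cfg [:: [::]; [::]; [::]; [::]; [::]; rev x; [::]; nseq T true; nseq n true; nseq m.+1 true; [::]; [::]] i y)
    f s' (60 * T + 14 * n + 40).
  move=> h ht'; eapply Exec_le.
    xstep Exec_pop.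
    xstep Exec_addu.
    rewrite size_nseq cats0.
    xstep Exec_readblk.
    rewrite size_nseq cats0 -/cs.
    xstep Exec_clear.
    eapply Exec_bind; first exact: Exec_simx hr.
    exact: h.
  rewrite /= !size_nseq size_rev size_mkseq -/n; lia.
case: hr2 => er; rewrite {}er in hr body.
- exists (Some (L x)); eexists; split; [|by left|by move=> *].
  apply: Exec_loop_stop; eapply Exec_le; first by apply: body (Exec_ret _ _ _) _.
  lia.
- have [o [s' [h1 h2 h3]]] := IH (drop T i).
  exists o, s'; split=> //.
    eapply Exec_le; first eapply Exec_loop_next; [by apply: body (Exec_ret _ _ _) _|exact: h1|].
    lia.
  case=> [|j] hj; first by rewrite mul0n drop0 -/cs hr.
  by move=> hh; apply: (h3 j) => //; rewrite drop_drop -mulSnr.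
Qed.

Lemma Exec_zpp_prog z : exists o s',
  [/\ Exec no_oracle zpp_prog (Cfg [:: [::]] (encp x z) [::]) o s'
        (11 + (20 * n + 20 + pcost p n + n.+1 * (60 * T + 14 * n + 40))),
      o = Some (L x) \/ o = None &
      forall j, j < n.+1 ->
        result M no_oracle (nth false (rev (blk T (drop (j * T) (enc z))))) (enc x) T = Some (Some (L x)) ->
        o = Some (L x)].
Proof.
have [o [s' [h1 h2 h3]]] := Exec_zpp_loop n.+1 (enc z) [::].
exists o, s'; split=> //.
apply: Exec_boot; eapply Exec_le => /=.
  eapply Exec_bind; first exact: Exec_readx.
  rewrite /= cats0.
  xstep Exec_addu.
  rewrite size_rev cats0.
  xstep Exec_push.
  xstep Exec_addu.
  rewrite size_rev cats0.
  xstep Exec_pevalp.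
  rewrite size_nseq; exact: h1.
rewrite /= size_nseq !size_rev -/n; lia.
Qed.
End ZPPProg.

(** * Averaging: few random strings settle all inputs *)

Section Greedy.
Variables (X R : finType) (bad : X -> pred R).
Hypothesis bad_half : forall x, 2 * #|[set r | bad x r]| <= #|R|.
Hypothesis R_gt0 : 0 < #|R|.

Lemma greedy_step (S : {set X}) : exists r, 2 * #|[set x in S | bad x r]| <= #|S|.
Proof.
apply/existsP; apply: contraT; rewrite negb_exists => /forallP h.
(* Otherwise every [r] is bad for more than half of [S]. Summation over [r] then counts more than
   half of the pairs in [S] times [R], whereas [bad_half], summed over [S], allows at most half. *)
have : \sum_(r : R) (#|S|).+1 <= \sum_(r : R) 2 * #|[set x in S | bad x r]|.
  by apply: leq_sum => r _; rewrite ltnNge h.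
rewrite sum_nat_const -big_distrr /=.
have -> : \sum_(r : R) #|[set x in S | bad x r]| = \sum_(x in S) #|[set r | bad x r]|.
  rewrite (eq_bigr (fun r => \sum_(x in S) (bad x r : nat))); last first.
    by move=> r _; rewrite -sum1dep_card big_mkcondr.
  rewrite exchange_big /=; apply: eq_bigr => x _.
  by rewrite -sum1dep_card [RHS]big_mkcond.
have : 2 * \sum_(x in S) #|[set r | bad x r]| <= #|S| * #|R|.
  by rewrite big_distrr /= -sum_nat_const; apply: leq_sum.
move=> h1 h2; have := leq_trans h2 h1; rewrite mulnC leq_pmul2r // ltnn //.
Qed.

Lemma greedy m : exists rs : seq R, size rs = m /\
  #|[set x | all (bad x) rs]| * 2 ^ m <= #|X|.
Proof.
elim: m => [|m [rs [sz h]]].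
  by exists [::]; split=> //=; rewrite muln1 max_card.
have [r hr] := greedy_step [set x | all (bad x) rs].
exists (r :: rs); split; first by rewrite /= sz.
apply: leq_trans h; rewrite expnS mulnA leq_mul2r; apply/orP; right.
rewrite mulnC; apply: leq_trans hr; rewrite leq_mul2l /=.
by apply/subset_leq_card/subsetP => x; rewrite !inE andbC.
Qed.
End Greedy.

Lemma blk_enc T j s (bs : seq (seq bool)) z : (forall b, b \in bs -> size b = T) -> j < size bs ->
  nth [::] bs j = s -> blk T (drop (j * T) (enc (flatten bs ++ z))) = s.
Proof.
move=> hb hj <-; elim: bs j hb hj => // b bs IH j hb hj.
have sb : size b = T by apply: hb; rewrite inE eqxx.
case: j hj => [|j] /= hj.
  rewrite mul0n drop0; apply: (@eq_from_nth _ false); rewrite size_mkseq // => i hi.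
  by rewrite nth_mkseq // /enc !map_cat -catA nth_cat size_map sb hi (nth_map false) ?sb.
rewrite -IH //; last by move=> c hc; apply: hb; rewrite inE hc orbT.
by rewrite mulSn addnC -drop_drop -catA {1}/enc map_cat drop_size_cat // size_map.
Qed.

Lemma nth_stream T (r : {ffun 'I_T -> bool}) d :
  stream r =1 nth false (mkseq (stream r) T ++ nseq d false).
Proof.
move=> i; rewrite nth_cat size_mkseq; case: ltnP => h; first by rewrite nth_mkseq.
by rewrite nth_nseq if_same /stream insubF // ltnNge h.
Qed.

Lemma ZPP_YP L : ZPP L -> YP L.
Proof.
case=> k [M hM].
pose p := polyb_list k.
pose t n := 11 + (20 * n + 20 + pcost p n + n.+1 * (60 * peval p n + 14 * n + 40)).
have ht : pb t by have hp := pb_pcost p; rewrite /t; pbnd.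
have [k' hk'] := pb_time ht.
have leT n : polyb k n <= peval p n by rewrite peval_polyb leq_polyb.
have hM' x c : result M no_oracle c (enc x) (peval p (size x)) = Some (Some (L x)) \/
               result M no_oracle c (enc x) (peval p (size x)) = Some None.
  by case: (hM x) => /(_ c) [h|h] _; [left|right]; apply: result_fuel h (leT _).
have [q hq] : exists q, forall n, n.+1 * peval p n <= peval q n.
  have [kq hkq] : pb (fun n => n.+1 * peval p n) by pbnd.
  exists (polyb_list kq) => n; apply: leq_trans (hkq n) _.
  by rewrite peval_polyb leq_polyb.
exists q, k', (toTM (zpp_prog M p)); split; last first.
  move=> x y; rewrite result_det.
  have [o [s' [h1 h2 _]]] := Exec_zpp_prog (hM' x) y.
  rewrite (resultL_Exec h1 (hk' _)).
  by case: h2 => ->; [left|right].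
move=> n; set T := peval p n.
pose bad (x : n.-tuple bool) (r : {ffun 'I_(polyb k n) -> bool}) :=
  result M no_oracle (stream r) (enc x) (polyb k n) == Some None.
have [||rs [srs hrs]] := @greedy _ _ bad _ _ n.+1.
- move=> x; case: (hM x) => _; rewrite size_tuple.
  by rewrite card_ffun card_bool card_ord.
- by rewrite card_ffun card_bool expn_gt0.
have {}hrs x : exists2 r, r \in rs & ~~ bad x r.
  (* If [c] inputs stay open for all the strings, then [c * 2 ^ n.+1 <= 2 ^ n], so [c] is 0: this is
     why [n.+1] strings are taken. *)
  apply/hasP; rewrite has_predC; apply/negP => hx.
  move: hrs; rewrite card_tuple card_bool expnS mulnA.
  have : 0 < #|[set x | all (bad x) rs]| by apply/card_gt0P; exists x; rewrite inE.
  move: #|_| => c c0; rewrite leqNgt ltn_Pmull ?expn_gt0 //; lia.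
(* The block is reversed because [readblk] pushes it onto a stack, and filled up because the program
   computes the length [peval p n], which may exceed the number [polyb k n] of random bits. *)
pose b (r : {ffun 'I_(polyb k n) -> bool}) := rev (mkseq (stream r) (polyb k n) ++ nseq (T - polyb k n) false) : seq bool.
pose bs := [seq b r | r <- rs].
have sb : forall s, s \in bs -> size s = T.
  by move=> s /mapP[r _ ->]; rewrite size_rev size_cat size_mkseq size_nseq subnKC // leT.
pose z := nseq (peval q n - n.+1 * T) false.
have sbs : size (flatten bs) = n.+1 * T.
  rewrite -srs -(size_map b) -/bs; elim: (bs) sb => //= s ss IH h.
  rewrite size_cat (h s) ?inE ?eqxx // mulSn IH // => s' hs'.
  by apply: h; rewrite inE hs' orbT.
exists (flatten bs ++ z); split.
  by rewrite size_cat sbs size_nseq subnKC // hq.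
move=> x sx; rewrite result_det -sx.
have [o [s' [h1 _ h3]]] := Exec_zpp_prog (hM' x) (flatten bs ++ z).
rewrite (resultL_Exec h1 (hk' _)); congr Some.
have [r hr nb] := hrs (Tuple (introT eqP sx)).
apply: (h3 (index r rs)); first by rewrite sx -srs index_mem.
rewrite sx -/T (@blk_enc T _ (b r)) //; last first.
- by rewrite (nth_map r) ?index_mem // nth_index.
- by rewrite size_map index_mem.
rewrite /b revK -(@result_ext _ _ (stream r)); last by move=> j _; apply: nth_stream.
have := hM x; rewrite sx => -[/(_ (stream r)) [] h _].
  by apply: result_fuel h (leT _).
by move: nb; rewrite /bad /= h eqxx.
Qed.

(** * The intersection of NE and coNE is contained in YE *)

Definition lval (l : seq bool) : nat := foldr (fun (b : bool) v => b + 2 * v) 0 l.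

Lemma lval_lt l : lval l < 2 ^ size l.
Proof. by elim: l => //= b l IH; rewrite expnS; case: b; lia. Qed.

Lemma lval_inj l l' : size l = size l' -> lval l = lval l' -> l = l'.
Proof.
elim: l l' => [|b l IH] [|b' l'] //= [hs] hv.
have hb : b = b' by case: b b' hv => [] []; lia.
by rewrite -hb (IH l') //; move: hv; rewrite -hb; lia.
Qed.

Section Lookup.
Variables (k : nat) (M1 M0 : TM).

Definition lookup : pM (option bool) :=
  addu 5 8 6 ;;; pow2 k 8 7 6 ;;; addu 7 9 6 ;;;
  forpop 5 (fun b => push 8 b ;;; dblskip b 7 6) ;;; mv 8 5 ;;; clear 7 ;;;
  readblk 9 4 10 ;;;
  o <- simx M1 ;;
  if o == Some true then ret (Some true) else
    mv 10 8 ;;; mv 8 4 ;;; o' <- simx M0 ;;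
    if o' == Some true then ret (Some false) else ret None.

Lemma Exec_skip O l w s u i y :
  Exec O (forpop 5 (fun b => push 8 b ;;; dblskip b 7 6))
    (Cfg [:: [::]; [::]; [::]; [::]; [::]; l; [::]; nseq u true; s; w; [::]; [::]] i y) tt
    (Cfg [:: [::]; [::]; [::]; [::]; [::]; [::]; [::]; nseq (2 ^ size l * u) true; rev l ++ s; w; [::]; [::]]
       (drop (u * lval l) i) y)
    (size l * (12 * (2 ^ size l * u) + 7) + 2).
Proof.
elim: l s u i => [|b l IH] s u i.
  by rewrite muln0 drop0 mul1n; exact: Exec_forpop_nil.
eapply Exec_le.
  eapply Exec_forpop_cons => //=.
    xstep Exec_push.
    exact: Exec_dblskip.
  rewrite /= size_nseq.
  have := IH (b :: s) (2 * u) (if b then drop u i else i).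
  rewrite mulnA -expnSr rev_cons cat_rcons.
  have -> : drop (2 * u * lval l) (if b then drop u i else i) = drop (u * (b + 2 * lval l)) i.
    by case: (b); rewrite ?drop_drop; congr drop; lia.
  exact.
rewrite /= size_nseq.
have : u <= 2 ^ (size l).+1 * u by rewrite leq_pmull // expn_gt0.
lia.
Qed.

Definition lcost n := n * (12 * (2 ^ n * expb k n) + 14) + 3 * (2 ^ n * expb k n) +
  (n + 1) * (k * (12 * expb k n + 4) + 3) + 150 * expb k n + 60 * n + 100.

Lemma eb_lcost : eb lcost.
Proof. by rewrite /lcost; ebnd. Qed.

Lemma Exec_lookup O x i y o1 o0 :
  let n := size x in
  let B := expb k n in
  let cs := rev (blk B (drop (B * lval (rev x)) i)) in
  result M1 no_oracle (nth false cs) (enc x) B = Some o1 ->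
  result M0 no_oracle (nth false cs) (enc x) B = Some o0 ->
  exists s', Exec O lookup
    (Cfg [:: [::]; [::]; [::]; [::]; [::]; rev x; [::]; [::]; [::]; [::]; [::]; [::]] i y)
    (if o1 == Some true then Some true else if o0 == Some true then Some false else None)
    s' (lcost n).
Proof.
move=> n B cs h1 h0.
have scs : size cs = B by rewrite size_rev size_mkseq.
eexists; eapply Exec_le.
  xstep Exec_addu.
  rewrite size_rev cats0 -/n.
  xstep Exec_pow2.
  rewrite size_nseq -/B.
  xstep Exec_addu.
  rewrite size_nseq cats0.
  eapply Exec_bind; first exact: Exec_skip.
  rewrite size_rev revK cats0 -/n.
  xstep Exec_mv.
  rewrite cats0.
  xstep Exec_clear.
  xstep Exec_readblk.
  rewrite size_nseq !cats0 -/cs.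
  eapply Exec_bind; first exact: Exec_simx h1.
  (* A cost valid for both outcomes of the first simulation, and an end configuration that may
     depend on [o1], are fixed before the case split. *)
  instantiate (1 := 83 * B + 14 * n + 3 * B + 7 * B + 30).
  instantiate (1 := if o1 == Some true then _ else _).
  case: ifP => _; first by eapply Exec_le; [exact: Exec_ret|lia].
  eapply Exec_le.
    xstep Exec_mv.
    rewrite cats0.
    xstep Exec_mv.
    rewrite revK cats0.
    eapply Exec_bind; first exact: Exec_simx h0.
    by case: ifP => _; exact: Exec_ret.
  rewrite /= size_rev !scs -/n; lia.
rewrite /= ?size_nseq ?size_rev ?size_nseq ?scs -/n -/B /lcost -/B. rewrite ?size_mkseq; lia.
Qed.
End Lookup.

Lemma NTIME_halts O T L M c x : (forall x : seq bool,
    (forall c, exists o, result M O c (enc x) (T (size x)) = Some o) /\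
    (L x <-> exists c, result M O c (enc x) (T (size x)) = Some (Some true))) ->
  exists o, result M O c (enc x) (T (size x)) = Some o /\ (o = Some true -> L x).
Proof.
move=> /(_ x) [/(_ c) [o h] hL]; exists o; split=> // e.
by apply/hL; exists c; rewrite -e.
Qed.

Lemma leq_expb k k' n : k <= k' -> expb k n <= expb k' n.
Proof. by move=> h; rewrite /expb leq_exp2l // leq_add // leq_mul. Qed.

(* The advice for length [n] concatenates one block of choice bits per [x] of
   size [n], in the order of [lval (rev x)]: an accepting run of [M1] if [L x],
   and of [M0] otherwise. *)
Lemma NE_coNE_lookup L : NE L -> coNE L -> exists k M1 M0,
  (forall O x i y, exists o s', Exec O (lookup k M1 M0)
     (Cfg [:: [::]; [::]; [::]; [::]; [::]; rev x; [::]; [::]; [::]; [::]; [::]; [::]] i y) o s' (lcost k (size x))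
     /\ (o = Some (L x) \/ o = None)) /\
  (forall n, exists2 a, size a = 2 ^ n * expb k n &
     forall O x z y, size x = n -> exists s', Exec O (lookup k M1 M0)
     (Cfg [:: [::]; [::]; [::]; [::]; [::]; rev x; [::]; [::]; [::]; [::]; [::]; [::]] (enc (a ++ z)) y)
     (Some (L x)) s' (lcost k n)).
Proof.
(* A common exponent makes the certificates of both machines equally long, so that the position of a
   block can be computed without knowing the answers before it. *)
move=> [k1 [M1 h1]] [k0 [M0 h0]]; set k := k1 + k0.
have l1 n : expb k1 n <= expb k n by apply: leq_expb; rewrite /k; lia.
have l0 n : expb k0 n <= expb k n by apply: leq_expb; rewrite /k; lia.
have hal1 c x : exists o, result M1 no_oracle c (enc x) (expb k (size x)) = Some o /\ (o = Some true -> L x).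
  have [o [h hl]] := NTIME_halts c x h1; exists o; split=> //; exact: result_fuel h (l1 _).
have hal0 c x : exists o, result M0 no_oracle c (enc x) (expb k (size x)) = Some o /\ (o = Some true -> ~~ L x).
  have [o [h hl]] := NTIME_halts c x h0; exists o; split=> //; exact: result_fuel h (l0 _).
exists k, M1, M0; split.
  move=> O x i y; set n := size x.
  set cs := rev (blk (expb k n) (drop (expb k n * lval (rev x)) i)).
  have [o1 [r1 t1]] := hal1 (nth false cs) x.
  have [o0 [r0 t0]] := hal0 (nth false cs) x.
  have [s' h] := Exec_lookup O y r1 r0.
  eexists; exists s'; split; first exact: h.
  case: eqP => [/t1 ->|_]; first by left.
  by case: eqP => [/t0 /negPf ->|_]; [left|right].
move=> n; set B := expb k n.
have certs (x : n.-tuple bool) : exists b : B.-tuple bool,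
    result (if L x then M1 else M0) no_oracle (nth false (rev b)) (enc x) B == Some (Some true).
  have [c hc] : exists c, result (if L x then M1 else M0) no_oracle c (enc x) B = Some (Some true).
    case: (boolP (L x)) => hx.
      have [_ [/(_ hx) [c hc] _]] := h1 x; exists c; apply: result_fuel hc _.
      by rewrite size_tuple l1.
    have [_ [/(_ hx) [c hc] _]] := h0 x; exists c; apply: result_fuel hc _.
    by rewrite size_tuple l0.
  have sb : size (rev (mkseq c B)) == B by rewrite size_rev size_mkseq.
  exists (Tuple sb); apply/eqP; rewrite /= revK -hc; apply: result_ext => j hj; by rewrite nth_mkseq.
pose cert x := xchoose (certs x).
(* The inverse of numbering the inputs by [lval (rev x)]. Injectivity of the numbering gives [strK];
   the default only makes the function total. *)
pose str v : n.-tuple bool := odflt [tuple of nseq n false] [pick x : n.-tuple bool | lval (rev x) == v].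
have strK (x : n.-tuple bool) : str (lval (rev x)) = x.
  rewrite /str; case: pickP => [x' /eqP h|/(_ x)]; last by rewrite eqxx.
  apply/val_inj/(can_inj revK)/lval_inj; last exact: h.
  by rewrite !size_rev [odflt _ _]/= !size_tuple.
pose bs := [seq tval (cert (str v)) | v <- iota 0 (2 ^ n)].
have sb s : s \in bs -> size s = B by move=> /mapP[v _ ->]; rewrite size_tuple.
have sbs : size bs = 2 ^ n by rewrite size_map size_iota.
exists (flatten bs).
  rewrite -sbs; elim: (bs) sb => //= s ss IH h.
  rewrite size_cat (h s) ?inE ?eqxx // mulSn IH // => s' hs'.
  by apply: h; rewrite inE hs' orbT.
move=> O x z y sx; subst n; pose X : (size x).-tuple bool := Tuple (eqxx (size x)).
have lv : lval (rev x) < 2 ^ size x by have := lval_lt (rev x); rewrite size_rev.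
have eb : blk B (drop (B * lval (rev x)) (enc (flatten bs ++ z))) = cert X.
  rewrite mulnC; apply: blk_enc; [exact: sb|by rewrite sbs|].
  by rewrite (nth_map 0) ?size_iota // nth_iota // add0n -[x]/(tval X) strK.
have /eqP hc := xchooseP (certs X); rewrite -/(cert X) -eb in hc.
set cs := rev _ in hc.
have [o1 [r1 t1]] := hal1 (nth false cs) x.
have [o0 [r0 t0]] := hal0 (nth false cs) x.
have [s' h] := Exec_lookup O y r1 r0.
exists s'; move: h; rewrite [tval X]/= in hc.
case: (boolP (L x)) hc => hx hc.
  by move: hc; rewrite r1 => -[->].
move: hc; rewrite r0 => -[->].
case: eqP => [/t1|_]; first by rewrite (negPf hx).
by rewrite eqxx.
Qed.

Lemma NE_coNE_YE L : NE L -> coNE L -> YE L.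
Proof.
move=> h1 h0; have [k [M1 [M0 [hs hc]]]] := NE_coNE_lookup h1 h0.
have hl := eb_lcost k.
have [k1 hk1] : exists k', forall n, 8 * (11 + (3 * n + 2 + lcost k n)) * (11 + (3 * n + 2 + lcost k n)) < expb k' n.
  by apply: (@eb_time (fun n => 11 + (3 * n + 2 + lcost k n))); ebnd.
have [k2 hk2] : eb (fun n => 2 ^ n * expb k n) by ebnd.
pose k' := k1 + k2.
pose prog := boot 11 (readx 5 ;;; lookup k M1 M0).
have run x z o s' : Exec no_oracle (lookup k M1 M0)
     (Cfg [:: [::]; [::]; [::]; [::]; [::]; rev x; [::]; [::]; [::]; [::]; [::]; [::]] (enc z) [::]) o s' (lcost k (size x)) ->
  result (toTM prog) no_oracle det_choices (encp x z) (expb k' (size x)) = Some o.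
  move=> h; rewrite result_det.
  have hT := leq_trans (hk1 (size x)) (leq_expb (size x) (leq_addr k2 k1)).
  apply: resultL_Exec hT.
  apply: Exec_boot; eapply Exec_bind; first exact: Exec_readx.
  rewrite /= cats0; exact: h.
exists (fun n => 2 ^ n * expb k n), k', (toTM prog); split; [|split].
- by move=> n; apply: leq_trans (hk2 n) _; apply: leq_expb; exact: leq_addl.
- move=> n; have [a sa ha] := hc n; exists a; split=> // x sx.
  have [s' h] := ha no_oracle x [::] [::] sx.
  by rewrite -sx; apply: run; rewrite sx -[a]cats0; exact: h.
- move=> x y; have [o [s' [h ho]]] := hs no_oracle x (enc y) [::].
  by rewrite (run _ _ _ _ h); case: ho => ->; [left|right].
Qed.

(** Replaces the streams of [NTIME_O] by lists of consumed bits: every list must lead to a halt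
    without false acceptance, and members need one accepting list. *)
Lemma NTIME_intro O T (m : pM (option bool)) (L : lang) (t : nat -> nat) :
  (forall n, 8 * t n * t n < T n) ->
  (forall x cho, exists o s', Exec O m (Cfg [:: [::]] (enc x) cho) o s' (t (size x)) /\
     (o = Some true -> L x)) ->
  (forall x, L x -> exists cho s', Exec O m (Cfg [:: [::]] (enc x) cho) (Some true) s' (t (size x))) ->
  NTIME_O O T L.
Proof.
move=> ht h1 h2; exists (toTM m) => x; split=> [c|].
  have [y ->] := resultL_result m O c (enc x) (T (size x)).
  have [o [s' [h _]]] := h1 x y; exists o; exact: resultL_Exec h (ht _).
split=> [hx|[c]].
  have [y [s' h]] := h2 x hx.
  have [c hc] := result_resultL m O y (enc x) (T (size x)).
  by exists c; rewrite hc; apply: resultL_Exec h (ht _).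
have [y ->] := resultL_result m O c (enc x) (T (size x)).
have [o [s' [h hL]]] := h1 x y; rewrite (resultL_Exec h (ht _)) => -[e].
exact: hL.
Qed.

Lemma det_nil M O w T : result M O det_choices w T = result M O (nth false [::]) w T.
Proof. by apply: result_ext => j _; rewrite nth_nil. Qed.

(** * YE is contained in NE and in coNE *)

(** Choice bits are taken in pairs; the first tells whether the second is kept. Thus every string of
    length at most [m] can be guessed, and the advice length, of which only a bound is known, need
    not be computed. *)
Fixpoint guess (m : nat) (c : seq bool) : seq bool :=
  if m is m'.+1 then
    (if head false c then [:: head false (behead c)] else [::]) ++ guess m' (behead (behead c))
  else [::].

Lemma size_guess m c : size (guess m c) <= m.
Proof. by elim: m c => //= m IH c; rewrite size_cat; have := IH (behead (behead c)); case: ifP => /=; lia. Qed.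

Lemma guess_onto m y : size y <= m -> exists c, guess m c = y.
Proof.
elim: m y => [|m IH] [|b y] //= h; first by exists [::].
  by have [c hc] := IH [::] isT; exists [:: false, false & c].
by have [c hc] := IH y h; exists [:: true, b & c]; rewrite /= hc.
Qed.

Definition guess_adv : pM unit :=
  forpop 7 (fun _ => a <- choose ;; b <- choose ;; if a then push 6 b else ret tt).

Lemma Exec_guess_adv O m x s R i c : exists c',
  Exec O guess_adv (Cfg [:: [::], [::], [::], [::], [::], x, s, nseq m true & R] i c) tt
    (Cfg [:: [::], [::], [::], [::], [::], x, rev (guess m c) ++ s, [::] & R] i c') (5 * m + 2).
Proof.
elim: m s c => [|m IH] s c; first by exists c; exact: Exec_forpop_nil.
have [c' h] := IH (if head false c then head false (behead c) :: s else s) (behead (behead c)).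
have hb : Exec O (if head false c then push 6 (head false (behead c)) else ret tt)
    (Cfg [:: [::], [::], [::], [::], [::], x, s, nseq m true & R] i (behead (behead c))) tt
    (Cfg [:: [::], [::], [::], [::], [::], x,
       (if head false c then head false (behead c) :: s else s), nseq m true & R] i (behead (behead c))) 1.
  by case: ifP => _; [exact: Exec_push|exact: Exec_ret].
exists c'; eapply Exec_le.
  eapply Exec_forpop_cons => //=.
    xstep Exec_choose.
    eapply Exec_bind; first exact: Exec_choose.
    exact: hb.
  have -> : rev (guess m.+1 c) ++ s = rev (guess m (behead (behead c))) ++
      (if head false c then head false (behead c) :: s else s).
    by rewrite /=; case: ifP => //= _; rewrite rev_cons cat_rcons.
  exact: h.
lia.
Qed.

Definition ye_prog k M v := boot 11 (
  readx 5 ;;; addu 5 8 6 ;;; pow2 k 8 7 6 ;;; guess_adv ;;;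
  o <- simxy M ;; ret (Some (o == Some v))).

Definition ye_cost k n := 11 + (14 * n + 50 + (n + 1) * (k * (12 * expb k n + 4) + 3) + 70 * expb k n + 14 * n).

Lemma Exec_ye_prog k M v x c o :
  result M no_oracle det_choices (encp x (guess (expb k (size x)) c)) (expb k (size x)) = Some o ->
  exists s', Exec no_oracle (ye_prog k M v) (Cfg [:: [::]] (enc x) c) (Some (o == Some v)) s'
    (ye_cost k (size x)).
Proof.
move=> h; have [c' hc] := Exec_guess_adv no_oracle (expb k (size x)) (rev x) [::] (nseq 4 [::]) [::] c.
rewrite cats0 in hc.
eexists; apply: Exec_boot; eapply Exec_le => /=.
  eapply Exec_bind; first by rewrite -[enc x]cats0; exact: Exec_readx.
  rewrite /= cats0.
  xstep Exec_addu.
  rewrite size_rev cats0.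
  xstep Exec_pow2.
  rewrite size_nseq.
  eapply Exec_bind; first exact: hc.
  eapply Exec_bind; first exact: Exec_simxy h.
  exact: Exec_ret.
rewrite /= size_nseq size_rev; have := size_guess (expb k (size x)) c; lia.
Qed.

Lemma YE_NE_coNE L : YE L -> NE L /\ coNE L.
Proof.
case=> a [k [M [ha [hc hs]]]].
have [k' hk'] : exists k', forall n, 8 * ye_cost k n * ye_cost k n < expb k' n.
  by apply: eb_time; rewrite /ye_cost; ebnd.
(* [v = true] gives membership in [NE], [v = false] in [coNE]. *)
suff H v : NE (fun x => L x == v).
  split; first by have [j hj] := H true; exists j; case: hj => M' hM'; exists M' => x; have := hM' x; case: (L x).
  by have [j hj] := H false; exists j; case: hj => M' hM'; exists M' => x; have := hM' x; case: (L x).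
exists k'; apply: (@NTIME_intro _ _ (ye_prog k M v) _ (ye_cost k)) => // [x c|x /eqP hx].
  have := hs x (guess (expb k (size x)) c); case=> h.
    have [s' h'] := Exec_ye_prog v h; eexists; exists s'; split; first exact: h'.
    by case=> /eqP[->].
  by have [s' h'] := Exec_ye_prog v h; eexists; exists s'; split; first exact: h'.
have [y [sy hy]] := hc (size x).
have [c ec] : exists c, guess (expb k (size x)) c = y by apply: guess_onto; rewrite sy.
have h := hy x erefl; rewrite -ec in h.
by have [s' h'] := Exec_ye_prog v h; exists c, s'; rewrite hx eqxx in h'.
Qed.

Definition det_prog M v := boot 11 (readx 5 ;;; o <- simx M ;; ret (Some (o == Some v))).

Lemma E_NE_coNE L : E L -> NE L /\ coNE L.
Proof.
case=> k [M hM].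
pose t n := 11 + (3 * n + 2 + (40 * expb k n + 14 * n + 15 + 1)).
have [k' hk'] : exists k', forall n, 8 * t n * t n < expb k' n.
  by apply: eb_time; rewrite /t; ebnd.
have main v x c : exists s', Exec no_oracle (det_prog M v) (Cfg [:: [::]] (enc x) c)
    (Some (Some (L x) == Some v)) s' (t (size x)).
  eexists; apply: Exec_boot; eapply Exec_le => /=.
    eapply Exec_bind; first by rewrite -[enc x]cats0; exact: Exec_readx.
    rewrite /= cats0.
    eapply Exec_bind; first by apply: (@Exec_simx _ _ _ _ [::]); rewrite -det_nil; exact: hM.
    exact: Exec_ret.
  by rewrite /=; lia.
split; exists k'.
- apply: (@NTIME_intro _ _ (det_prog M true) _ t) => // [x c|x hx].
    have [s' h] := main true x c; eexists; exists s'; split; first exact: h.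
    by case=> /eqP[->].
  by have [s' h] := main true x [::]; rewrite hx in h; exists [::], s'.
- apply: (@NTIME_intro _ _ (det_prog M false) _ t) => // [x c|x hx].
    have [s' h] := main false x c; eexists; exists s'; split; first exact: h.
    by case=> /eqP[->].
  by have [s' h] := main false x [::]; rewrite (negPf hx) in h; exists [::], s'.
Qed.

(** * P = YP implies E = NE ∩ coNE *)

(* The length of [z] determines that of [unpad z], so the padded inputs of a
   given length can share the advice for one length of [L]. *)
Definition unpad (z : seq bool) := take (size (bits (size z))).-2 z.
Definition padded (L : lang) : lang := fun z => L (unpad z).
(** The length [2 ^ n.+1] is [expb 1 n], which [pow2 1] produces. Its binary expansion has [n + 2]
    digits, whence the two digits discounted in [unpad]. *)
Definition pad (x : seq bool) := x ++ nseq (2 ^ (size x).+1 - size x) false.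

Lemma size_pad x : size (pad x) = 2 ^ (size x).+1.
Proof.
rewrite size_cat size_nseq subnKC //; apply: ltnW.
by apply: leq_trans (ltn_expl _ (leqnn 2)) _; rewrite leq_exp2l.
Qed.

Lemma padK x : unpad (pad x) = x.
Proof. by rewrite /unpad size_pad size_bits_exp /= /pad take_size_cat. Qed.

Lemma size_unpad z : size (unpad z) = (size (bits (size z))).-2.
Proof.
rewrite size_takel //; have := exp_size_bits_pred (size z).
have := ltn_expl (size (bits (size z))).-1 (leqnn 2); lia.
Qed.

Lemma exp_size_unpad z : 2 ^ size (unpad z) <= (size z).+1.
Proof.
apply: leq_trans (exp_size_bits_pred _); rewrite size_unpad leq_exp2l //; lia.
Qed.

(** [2 ^ (k * n + k)] is [(2 ^ n) ^ k * 2 ^ k]. With [N] the length of a padded word and [n] that of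
    its content, exponential cost in [n] becomes polynomial in [N]. *)
Lemma eb_pb f : eb f -> exists2 g, pb g & forall n N, 2 ^ n <= N.+1 -> f n <= g N.
Proof.
case=> k hk; exists (fun N => N.+1 ^ k * 2 ^ k); first by pbnd.
move=> n N h; apply: leq_trans (hk n) _; rewrite /expb expnD mulnC expnM mulnC.
rewrite leq_mul // -expnM mulnC expnM; by case: (k) => // k'; rewrite leq_exp2r.
Qed.

(** Register 10 receives the binary digits of the length of the input. After two of them are popped,
    only the number of the remaining ones matters: it counts the bits to keep. *)
Definition unpad_prog : pM unit :=
  readx 8 ;;; mv 8 6 ;;; addu 6 8 9 ;;; tobin 8 9 10 7 ;;; pop 10 ;;; pop 10 ;;;
  forpop 10 (fun _ => o <- pop 6 ;; if o is Some b then push 5 b else ret tt) ;;; clear 6.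

Lemma Exec_unpad_prog O z i y : ~~ is_bit (head Blank i) ->
  Exec O unpad_prog (Cfg (nseq 12 [::]) (map Bit z ++ i) y) tt
    (Cfg [:: [::]; [::]; [::]; [::]; [::]; rev (unpad z); [::]; [::]; [::]; [::]; [::]; [::]] (behead i) y)
    (60 * size z + 60).
Proof.
move=> hi.
have aux l : forall u s, Exec O (forpop 10 (fun _ => o <- pop 6 ;; if o is Some b then push 5 b else ret tt))
  (Cfg [:: [::]; [::]; [::]; [::]; [::]; s; u; [::]; [::]; [::]; l; [::]] (behead i) y) tt
  (Cfg [:: [::]; [::]; [::]; [::]; [::]; rev (take (size l) u) ++ s; drop (size l) u; [::]; [::]; [::]; [::]; [::]] (behead i) y)
  (4 * size l + 2).
  elim: l => [|b l IH] u s; first by rewrite take0 drop0; exact: Exec_forpop_nil.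
  case: u => [|c u].
    eapply Exec_le.
      eapply Exec_forpop_cons => //=; first by xstep Exec_pop; exact: Exec_ret.
      exact: (IH [::]).
    by rewrite /=; lia.
  eapply Exec_le.
    eapply Exec_forpop_cons => //=; first by xstep Exec_pop; exact: Exec_push.
    rewrite /= rev_cons cat_rcons; exact: IH.
  by rewrite /=; lia.
eapply Exec_le => /=.
  eapply Exec_bind; first exact: Exec_readx.
  rewrite /= cats0.
  xstep Exec_mv.
  rewrite cats0 revK.
  xstep Exec_addu.
  rewrite cats0.
  xstep Exec_tobin.
  rewrite size_nseq.
  xstep Exec_pop.
  xstep Exec_pop.
  eapply Exec_bind; first exact: aux.
  rewrite cats0 !size_behead; exact: Exec_clear.
rewrite /= size_rev size_nseq size_drop !size_behead -size_unpad.
have : size (unpad z) <= size z by rewrite size_take_min geq_minr.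
lia.
Qed.

Lemma padded_YP L : NE L -> coNE L -> YP (padded L).
Proof.
move=> h1 h0; have [k [M1 [M0 [hs hc]]]] := NE_coNE_lookup h1 h0.
have [g pg hg] := eb_pb (eb_lcost k).
have [k1 hk1] : exists k', forall n, 8 * (11 + (60 * n + 60 + g n)) * (11 + (60 * n + 60 + g n)) < polyb k' n.
  by apply: (@pb_time (fun n => 11 + (60 * n + 60 + g n))); pbnd.
have hebq : eb (fun n => 2 ^ n * expb k n) by ebnd.
have [q [kq hkq] hq] := eb_pb hebq.
pose prog := boot 11 (unpad_prog ;;; lookup k M1 M0).
have run x z o s' : Exec no_oracle (lookup k M1 M0)
     (Cfg [:: [::]; [::]; [::]; [::]; [::]; rev (unpad x); [::]; [::]; [::]; [::]; [::]; [::]] (enc z) [::])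
       o s' (lcost k (size (unpad x))) ->
  result (toTM prog) no_oracle det_choices (encp x z) (polyb k1 (size x)) = Some o.
  move=> h; rewrite result_det.
  apply: resultL_Exec (hk1 (size x)).
  apply: Exec_boot; eapply Exec_bind; first exact: Exec_unpad_prog.
  by apply: Exec_le h _; apply: hg; apply: exp_size_unpad.
exists (polyb_list kq), k1, (toTM prog); split.
- move=> N; pose n := (size (bits N)).-2.
  have [a sa ha] := hc n.
  exists (a ++ nseq (polyb kq.+1 N - size a) false); split.
    rewrite size_cat size_nseq peval_polyb subnKC // sa.
    apply: leq_trans (leq_polyb _ _); apply: leq_trans (hkq N); apply: hq.
    by have := exp_size_unpad (nseq N false); rewrite size_unpad size_nseq.
  move=> z sz.
  have su : size (unpad z) = n by rewrite size_unpad sz.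
  have [s' h] := ha no_oracle (unpad z) (nseq (polyb kq.+1 N - size a) false) [::] su.
  have hr := run z (a ++ nseq (polyb kq.+1 N - size a) false) (Some (L (unpad z))) s'.
  by rewrite su sz in hr; exact: hr h.
- move=> x y; have [o [s' [h ho]]] := hs no_oracle (unpad x) (enc y) [::].
  by rewrite (run _ _ _ _ h); case: ho => ->; [left|right].
Qed.

Lemma eb_exp f k : eb f -> eb (fun n => f n ^ k).
Proof.
move=> h; elim: k => [|k IH]; first by apply: eb_le (eb_const 1) => n.
by apply: eb_le (eb_mul h IH) => n; rewrite expnS.
Qed.

(** One unit is popped from [2 ^ n.+1] for each of the [n] input bits. The zeros go onto the
    simulated tape before [x], since that register is filled from the right end of the word. *)
Definition pad_prog M := boot 11 (
  readx 5 ;;; addu 5 8 6 ;;; pow2 1 8 7 6 ;;; addu 5 8 6 ;;;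
  forpop 8 (fun _ => pop 7 ;;; ret tt) ;;; forpop 7 (fun _ => pushsym 1 (Bit false)) ;;;
  load 5 1 6 ;;; simc M).

Lemma padded_P_E L : P (padded L) -> E L.
Proof.
case=> k [M hM].
pose t n := 11 + (60 * n + 60 + (n + 1) * (12 * expb 1 n + 7) + 20 * expb 1 n +
   40 * ((expb 1 n) ^ k + k)).
have [k' hk'] : exists k', forall n, 8 * t n * t n < expb k' n.
  apply: eb_time; rewrite /t; have := @eb_exp _ k (eb_expb 1) => ?; ebnd.
exists k', (toTM (pad_prog M)) => x; rewrite result_det.
set n := size x; set R := [:: [::]; [::]; [::]; [::]] : seq (seq bool).
have aux1 m : forall l, m <= l -> Exec no_oracle (forpop 8 (fun _ => pop 7 ;;; ret tt))
  (Cfg [:: [::]; [::]; [::]; [::]; [::]; rev x; [::]; nseq l true; nseq m true; [::]; [::]; [::]] [::] [::]) tt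
  (Cfg [:: [::]; [::]; [::]; [::]; [::]; rev x; [::]; nseq (l - m) true; [::]; [::]; [::]; [::]] [::] [::]) (4 * m + 2).
  elim: m => [|m IH] l hl; first by rewrite subn0; exact: Exec_forpop_nil.
  case: l hl => // l hl; eapply Exec_le.
    eapply Exec_forpop_cons => //=; first by xstep Exec_pop; exact: Exec_ret.
    by rewrite subSS; exact: IH.
  lia.
have aux2 m : forall w, Exec no_oracle (forpop 7 (fun _ => pushsym 1 (Bit false)))
  (Cfg [:: [::]; encs w; [::]; [::]; [::]; rev x; [::]; nseq m true; [::]; [::]; [::]; [::]] [::] [::]) tt
  (Cfg [:: [::]; encs (nseq m (Bit false) ++ w); [::]; [::]; [::]; rev x; [::]; [::]; [::]; [::]; [::]; [::]] [::] [::]) (4 * m + 2).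
  elim: m => [|m IH] w; first exact: Exec_forpop_nil.
  eapply Exec_le.
    eapply Exec_forpop_cons => //=; first exact: Exec_pushsym.
    rewrite /=; have := IH (Bit false :: w); rewrite -cat_rcons -[rcons _ _]cats1 -[[:: Bit false]]/(nseq 1 (Bit false)) -nseqD addn1; exact.
  lia.
have hT : 8 * t n * t n < expb k' n by [].
have hz : n <= 2 ^ (1 * n + 1).
  apply: ltnW; apply: leq_trans (ltn_expl _ (leqnn 2)) _; rewrite leq_exp2l //; lia.
have ez : enc x ++ nseq (expb 1 n - n) (Bit false) = enc (pad x).
  by rewrite /pad /enc map_cat map_nseq /expb mul1n addn1.
eapply resultL_Exec; last exact: hT.
apply: Exec_boot; eapply Exec_le => /=.
  eapply Exec_bind; first by rewrite -[enc x]cats0; exact: Exec_readx.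
  rewrite /= cats0.
  xstep Exec_addu.
  rewrite size_rev cats0 -/n.
  xstep Exec_pow2.
  rewrite size_nseq.
  xstep Exec_addu.
  rewrite size_rev cats0 -/n.
  eapply Exec_bind; first exact: aux1.
  eapply Exec_bind; first exact: (@aux2 _ [::]).
  xstep Exec_load.
  rewrite revK cats0 -encs_cat -/(enc x) ez.
  apply: (@Exec_simc _ _ (polyb k (size (pad x))) _ [::]).
  rewrite -det_nil hM /padded padK //.
rewrite /= size_nseq size_rev size_map size_pad -/n /polyb -[2 ^ n.+1]/(2 ^ n.+1).
have -> : 2 ^ n.+1 = expb 1 n by rewrite /expb mul1n addn1.
have : expb 1 n - n <= expb 1 n by apply: leq_subr.
rewrite !mul1n; lia.
Qed.

(** * E = NE^(NP^NP) implies P = YP *)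

Lemma polyb_mono k n m : n <= m -> polyb k n <= polyb k m.
Proof. by move=> h; rewrite /polyb leq_add2r; case: k => // k; rewrite leq_exp2r. Qed.

(* [w] is read as [1^n 0 u] with [n = pn w] and [u = pu w]. *)
Definition pn (w : seq bool) := find negb w.
Definition pu (w : seq bool) := drop (pn w).+1 w.
Definition mk n u := nseq n true ++ false :: u.

Lemma pn_mk n u : pn (mk n u) = n.
Proof. by rewrite /pn /mk; elim: n => //= n ->. Qed.

Lemma pu_mk n u : pu (mk n u) = u.
Proof. by rewrite /pu pn_mk /mk -cat_rcons drop_size_cat // size_rcons size_nseq. Qed.

Lemma size_pn w : pn w <= size w. Proof. exact: find_size. Qed.
Lemma size_pu w : size (pu w) <= size w. Proof. by rewrite size_drop leq_subr. Qed.

Definition readones : pM unit :=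
  loop (fun _ : unit => s <- read ;;
    if s is Bit true then push 8 true ;;; ret (inl tt) else ret (inr tt)) tt.

Lemma Exec_readones O w r y : 8 < size r ->
  Exec O readones (Cfg r (enc w) y) tt
    (Cfg (upd r 8 (nseq (pn w) true ++ get r 8)) (enc (pu w)) y) (3 * size w + 2).
Proof.
elim: w r => [|[] w IH] r hr.
- rewrite /= upd_get; apply: Exec_loop_stop; apply: (@Exec_le _ _ _ _ _ _ (1 + 1)) => //.
  by eapply Exec_bind; [exact: Exec_read|exact: Exec_ret].
- eapply Exec_le.
    eapply Exec_loop_next.
      eapply Exec_bind; first exact: Exec_read.
      rewrite /=; eapply Exec_bind; [exact: Exec_push|exact: Exec_ret].
    have := IH (upd r 8 (true :: get r 8)); rewrite size_upd get_upd // eqxx upd_upd nseq_catS => /(_ hr).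
    exact.
  by rewrite /=; lia.
- eapply Exec_le.
    apply: Exec_loop_stop; eapply Exec_bind; first exact: Exec_read.
    rewrite /pn /pu /= drop0 upd_get; exact: Exec_ret.
  by rewrite /=; lia.
Qed.

Definition guess_all i j : pM unit := forpop i (fun _ => b <- choose ;; push j b).
Definition bits_of (n : nat) (c : seq bool) := mkseq (nth false c) n.

Lemma Exec_guess_all O i j n r inp c : i < size r -> j < size r -> i <> j ->
  get r i = nseq n true ->
  Exec O (guess_all i j) (Cfg r inp c) tt
    (Cfg (upd (upd r i [::]) j (rev (bits_of n c) ++ get r j)) inp (drop n c)) (4 * n + 2).
Proof.
move=> ir jr ij; elim: n r c ir jr => [|n IH] r c ir jr e.
  have e' := upd_get r i; rewrite e in e'; rewrite e' /= upd_get drop0; exact: Exec_forpop_nil.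
eapply Exec_le.
  eapply (Exec_forpop_cons ir e).
    eapply Exec_bind; first exact: Exec_choose.
    by apply: Exec_push; rewrite size_upd.
  set r1 := upd _ j _.
  have := IH r1 (behead c); rewrite !size_upd => /(_ ir jr).
  have -> : get r1 i = nseq n true by rewrite /r1; reg_get.
  have -> : get r1 j = head false c :: get r j by rewrite /r1; reg_get.
  move=> /(_ erefl); rewrite behead_drop.
  have -> : bits_of n.+1 c = head false c :: bits_of n (behead c).
    rewrite /bits_of /mkseq /= -[1]addn0 iotaDl -map_comp; case: (c) => [|b c'] //=.
    by congr (_ :: _); apply: eq_map => k /=; rewrite !nth_nil.
  set r2 := upd _ j _; set r3 := upd _ j _; suff -> : r2 = r3 by apply.
  by rewrite /r2 /r3 /r1 {r2 r3 r1} rev_cons cat_rcons; reg_eq.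
by lia.
Qed.

Lemma size_bits_of n c : size (bits_of n c) = n. Proof. exact: size_mkseq. Qed.

Lemma bits_of_id n y : size y = n -> bits_of n y = y.
Proof. by move=> <-; exact: mkseq_nth. Qed.

(** * Bad advice, prefixes of good advice, and prefix search *)

Section IV.
Variables (L : lang) (p : seq nat) (k : nat) (A : TM).
Hypothesis good : forall n, exists y, size y = peval p n /\
  forall x, size x = n ->
    result A no_oracle det_choices (encp x y) (polyb k n) = Some (Some (L x)).
Hypothesis sound : forall x y,
  result A no_oracle det_choices (encp x y) (polyb k (size x)) = Some (Some (L x)) \/
  result A no_oracle det_choices (encp x y) (polyb k (size x)) = Some None.

Definition ares x y : option bool :=
  odflt None (result A no_oracle det_choices (encp x y) (polyb k (size x))).

Lemma aresE x y : result A no_oracle det_choices (encp x y) (polyb k (size x)) = Some (ares x y).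
Proof. by rewrite /ares; case: (sound x y) => ->. Qed.

(** By [sound] a definite answer is never wrong, so advice fails exactly if some input gets the
    answer [None]. Such an input is a polynomial-time checkable witness. *)
Definition badadv : lang := fun w => [exists x : (pn w).-tuple bool, ares x (pu w) == None].

Definition bad_prog := boot 11 (
  readones ;;; readx 6 ;;; guess_all 8 5 ;;; o <- simxy A ;; ret (Some (o == None))).

Lemma badadv_NP : NP badadv.
Proof.
pose t n := 11 + (40 * n + 60 + 40 * polyb k n).
have [k' hk'] : exists k', forall n, 8 * t n * t n < polyb k' n.
  by apply: pb_time; rewrite /t; pbnd.
have main w c : exists s', Exec no_oracle bad_prog (Cfg [:: [::]] (enc w) c)
    (Some (ares (bits_of (pn w) c) (pu w) == None)) s' (t (size w)).
  have h := aresE (bits_of (pn w) c) (pu w).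
  eexists; apply: Exec_boot; eapply Exec_le => /=.
    eapply Exec_bind; first exact: Exec_readones.
    eapply Exec_bind; first by rewrite -[enc (pu w)]cats0; exact: Exec_readx.
    rewrite /= !cats0.
    eapply Exec_bind; first exact: Exec_guess_all.
    rewrite /= cats0.
    eapply Exec_bind; first exact: Exec_simxy h.
    exact: Exec_ret.
  rewrite size_bits_of; have := polyb_mono k (size_pn w); have := size_pn w; have := size_pu w; lia.
exists k'; apply: (@NTIME_intro _ _ bad_prog _ t) => // [w c|w /existsP[x hx]].
  have [s' h] := main w c; eexists; exists s'; split; first exact: h.
  case=> e; apply/existsP.
  have sz : size (bits_of (pn w) c) == pn w by rewrite size_bits_of.
  by exists (Tuple sz); rewrite /= e.
have [s' h] := main w x; exists x, s'.
have ex : bits_of (pn w) x = x.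
  by rewrite bits_of_id ?size_tuple.
by rewrite ex hx in h.
Qed.

Lemma badadv_mk n y : ~~ badadv (mk n y) -> forall x, size x = n -> ares x y = Some (L x).
Proof.
rewrite /badadv pu_mk => /existsPn h x sx.
have sz : size x == pn (mk n y) by rewrite pn_mk sx.
have := h (Tuple sz); rewrite /= /ares.
by case: (sound x y) => -> //.
Qed.

Definition prefadv : lang := fun w =>
  (size (pu w) <= peval p (pn w)) &&
  [exists v : (peval p (pn w) - size (pu w)).-tuple bool, ~~ badadv (mk (pn w) (pu w ++ v))].

(** Register 11 grows into the oracle query; the copy in register 6 measures the length of the
    prefix for [subtract]. *)
Definition echo : pM unit :=
  loop (fun _ : unit => s <- read ;;
    if s is Bit b then push 11 b ;;; push 6 b ;;; ret (inl tt) else ret (inr tt)) tt.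

Lemma Exec_echo O u r y : 11 < size r ->
  Exec O echo (Cfg r (enc u) y) tt
    (Cfg (upd (upd r 11 (rev u ++ get r 11)) 6 (rev u ++ get r 6)) [::] y) (4 * size u + 2).
Proof.
elim: u r => [|b u IH] r hr.
  rewrite /= !upd_get; apply: Exec_loop_stop; apply: (@Exec_le _ _ _ _ _ _ (1 + 1)) => //.
  by eapply Exec_bind; [exact: Exec_read|exact: Exec_ret].
have h6 : 6 < size r by lia.
eapply Exec_le.
  eapply Exec_loop_next.
    eapply Exec_bind; first exact: Exec_read.
    rewrite /=; eapply Exec_bind; first exact: Exec_push.
    eapply Exec_bind; first by apply: Exec_push; rewrite size_upd.
    exact: Exec_ret.
  set r1 := upd _ 6 _.
  have := IH r1; rewrite !size_upd => /(_ hr).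
  have -> : get r1 11 = b :: get r 11 by rewrite /r1; reg_get.
  have -> : get r1 6 = b :: get r 6 by rewrite /r1; reg_get.
  set r2 := upd _ 6 _; set r3 := upd _ 6 _; suff -> : r2 = r3 by apply.
  by rewrite /r2 /r3 /r1 {r2 r3 r1} !rev_cons !cat_rcons; reg_eq.
by rewrite /=; lia.
Qed.

Definition subtract : pM bool :=
  loop (fun _ : unit => o <- pop 6 ;;
    if o is Some _ then
      o' <- pop 7 ;; if o' is Some _ then ret (inl tt) else ret (inr false)
    else ret (inr true)) tt.

Lemma Exec_subtract O s m a5 R i y : exists s',
  Exec O subtract (Cfg [:: [::], [::], [::], [::], [::], a5, s, nseq m true & R] i y)
    (size s <= m) s' (3 * size s + 2) /\
  (size s <= m -> s' = Cfg [:: [::], [::], [::], [::], [::], a5, [::], nseq (m - size s) true & R] i y).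
Proof.
elim: s m => [|b s IH] m.
  eexists; split; last by rewrite subn0.
  apply: Exec_loop_stop; apply: (@Exec_le _ _ _ _ _ _ (1 + 1)) => //.
  by xstep Exec_pop; exact: Exec_ret.
case: m => [|m].
  eexists; split.
    eapply Exec_le; first eapply Exec_loop_stop.
      by xstep Exec_pop; xstep Exec_pop; exact: Exec_ret.
    by rewrite /=; lia.
  by [].
have [s' [h1 h2]] := IH m; exists s'; split; last by rewrite ltnS subSS.
eapply Exec_le; first eapply Exec_loop_next.
    by xstep Exec_pop; xstep Exec_pop; exact: Exec_ret.
  exact: h1.
by rewrite /=; lia.
Qed.

(** The query is read from the bottom of register 11. Pushing the ones, the [false], the given
    prefix and the guessed rest in this order therefore yields [mk n (u ++ v)]. *)
Definition pref_prog := boot 11 (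
  readones ;;; addu 8 11 6 ;;; push 11 false ;;; echo ;;; pevalp p 8 7 9 10 ;;;
  ok <- subtract ;;
  if ok then guess_all 7 11 ;;; a <- ask ;; ret (Some (~~ a)) else ret (Some false)).

Lemma prefadv_NP : NP_O badadv prefadv.
Proof.
pose t n := 11 + (40 * n + 60 + (pcost p n + 5 * peval p n)).
have hp := pb_pcost p.
have [k' hk'] : exists k', forall n, 8 * t n * t n < polyb k' n.
  by apply: pb_time; rewrite /t; pbnd.
have mono_peval q n m : n <= m -> peval q n <= peval q m.
  by move=> h; elim: q => [|c q IH]; rewrite ?/peval ?big_ord0 // -!/(peval _ _) !peval_cons leq_add2l leq_mul.
have mono_pcost n m : n <= m -> pcost p n <= pcost p m.
  move=> h; elim: (p) => //= c q IH; have hq := mono_peval q _ _ h.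
  by rewrite !leq_add // ?leq_mul // ?leq_add2r ?leq_mul.
have main w c : exists s', Exec badadv pref_prog (Cfg [:: [::]] (enc w) c)
    (Some ((size (pu w) <= peval p (pn w)) &&
       ~~ badadv (mk (pn w) (pu w ++ bits_of (peval p (pn w) - size (pu w)) c)))) s' (t (size w)).
  have [s1 [h1 h2]] := Exec_subtract badadv (rev (pu w)) (peval p (pn w)) [::]
     [:: nseq (pn w) true; [::]; [::]; rev (pu w) ++ false :: nseq (pn w) true] [::] c.
  have tail : exists s', Exec badadv (if size (rev (pu w)) <= peval p (pn w)
       then guess_all 7 11 ;;; a <- ask ;; ret (Some (~~ a)) else ret (Some false)) s1
      (Some ((size (pu w) <= peval p (pn w)) &&
       ~~ badadv (mk (pn w) (pu w ++ bits_of (peval p (pn w) - size (pu w)) c)))) s' (4 * peval p (pn w) + 4).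
    move: h2; rewrite size_rev; case: leqP => [_ /(_ isT) ->|_ _]; last first.
      by exists s1; apply: Exec_le (Exec_ret _ _ _) _; lia.
    eexists; eapply Exec_le.
      eapply Exec_bind; first exact: Exec_guess_all.
      rewrite /=; eapply Exec_bind; first exact: Exec_ask.
      rewrite /= catA -rev_cat rev_cat revK rev_cons rev_nseq cat_rcons.
      exact: Exec_ret.
    by lia.
  have {tail} [s' tail] := tail.
  exists s'; apply: Exec_boot; eapply Exec_le => /=.
    eapply Exec_bind; first exact: Exec_readones.
    rewrite /= cats0.
    xstep Exec_addu.
    rewrite size_nseq cats0.
    xstep Exec_push.
    eapply Exec_bind; first exact: Exec_echo.
    rewrite /= cats0.
    xstep Exec_pevalp.
    rewrite size_nseq.
    eapply Exec_bind; first exact: h1.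
    exact: tail.
  rewrite /= !size_nseq size_rev; have := size_pn w; have := size_pu w.
  have := mono_peval p _ _ (size_pn w); have := mono_pcost _ _ (size_pn w); lia.
exists k'; apply: (@NTIME_intro _ _ pref_prog _ t) => // [w c|w /andP[hs /existsP[v hv]]].
  have [s' h] := main w c; eexists; exists s'; split; first exact: h.
  case=> /andP[hs hb]; rewrite /prefadv hs; apply/existsP.
  have sz : size (bits_of (peval p (pn w) - size (pu w)) c) == peval p (pn w) - size (pu w).
    by rewrite size_bits_of.
  by exists (Tuple sz).
have [s' h] := main w v; exists v, s'.
have ex : bits_of (peval p (pn w) - size (pu w)) v = v.
  by rewrite bits_of_id ?size_tuple.
by rewrite hs ex hv in h.
Qed.

Lemma prefadv_mk n u : prefadv (mk n u) = (size u <= peval p n) &&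
  [exists v : (peval p n - size u).-tuple bool, ~~ badadv (mk n (u ++ v))].
Proof. by rewrite /prefadv pn_mk pu_mk. Qed.

(* Prefix search, trying the bit 1 first: [build n (peval p n)] is the
   lexicographically largest good advice for length [n]. *)
Fixpoint build n m : seq bool :=
  if m is m'.+1 then rcons (build n m') (prefadv (mk n (rcons (build n m') true))) else [::].

Lemma size_build n m : size (build n m) = m.
Proof. by elim: m => //= m IH; rewrite size_rcons IH. Qed.

(** Invariant of the search: the prefix found so far extends to good advice. Existence of good
    advice starts it at the empty prefix. *)
Lemma prefadv_build n m : m <= peval p n -> prefadv (mk n (build n m)).
Proof.
elim: m => [|m IH] h; rewrite /=.
  rewrite prefadv_mk /=; have [y [sy hy]] := good n.
  have sz : size y == peval p n - size (@nil bool) by rewrite subn0 sy.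
  apply/existsP; exists (Tuple sz); rewrite /= /badadv pu_mk; apply/existsPn => x.
  have sx : size x = n by rewrite size_tuple pn_mk.
  by rewrite /ares sx hy.
case: (boolP (prefadv (mk n (rcons (build n m) true)))) => // np.
(* The extension [v] of the shorter prefix is nonempty; a first bit 1 would contradict [np], so its
   first bit is 0 and its tail extends the new prefix. *)
move: (IH (ltnW h)); rewrite prefadv_mk => /andP[_ /existsP[v hv]].
rewrite prefadv_mk size_rcons size_build h.
case: v hv => [[|b v] /= sv] hv; first by move: sv; rewrite size_build eq_sym subn_eq0 leqNgt h.
have sv' : size v == peval p n - m.+1 by move: (sv); rewrite size_build subnS => /eqP <-.
case: b hv {sv} => hv; last first.
  apply/existsP; have e : size (rcons (build n m) false) = m.+1 by rewrite size_rcons size_build.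
  have sv2 : size v == peval p n - m.+1 by [].
  by exists (Tuple sv2); rewrite /= cat_rcons.
move: np; rewrite prefadv_mk size_rcons size_build h /= => /existsPn /(_ (Tuple sv')).
by rewrite /= cat_rcons hv.
Qed.

Lemma build_good n x : size x = n ->
  result A no_oracle det_choices (encp x (build n (peval p n))) (polyb k (size x)) = Some (Some (L x)).
Proof.
move=> sx; rewrite aresE (badadv_mk _ sx) //.
have := prefadv_build (leqnn (peval p n)); rewrite prefadv_mk size_build => /andP[_ /existsP[v]].
by case: v => -[|b v] /= sv; [rewrite cats0|move: sv; rewrite subnn].
Qed.

(* The first number of a pair is written [1 b_1 1 b_2 .. 0], to be self-delimiting. *)
Fixpoint pairs (acc : nat) (w : seq bool) : nat * seq bool :=
  match w with
  | true :: b :: w' => pairs (2 * acc + b) w'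
  | [:: true] => (2 * acc, [::])
  | false :: w' => (acc, w')
  | [::] => (acc, [::])
  end.
Definition unb (w : seq bool) := foldl (fun a (b : bool) => 2 * a + b) 0 w.

(** Bit [i] of the search result is the last bit of the prefix of length [i + 1]; later bits do not
    influence it. *)
Definition advbit : lang := fun w =>
  let: (n, w') := pairs 0 w in last false (build n (unb w').+1).

Definition double_add j (s : sym) : pM unit :=
  dblskip false j 6 ;;; (if s is Bit true then push j true else ret tt).

Lemma Exec_double_add O j a s r i y : j < size r -> 6 < size r -> j <> 6 -> get r 6 = [::] ->
  get r j = nseq a true ->
  Exec O (double_add j s) (Cfg r i y) tt (Cfg (upd r j (nseq (2 * a + bit_of s) true)) i y) (12 * a + 5).
Proof.
move=> jr r6 j6 e6 e; eapply Exec_le.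
  eapply Exec_bind; first exact: Exec_dblskip.
  have e2 : upd r j (nseq (2 * a + true) true) =
    upd (upd r j (nseq (2 * size (get r j)) true)) j (true :: get (upd r j (nseq (2 * size (get r j)) true)) j).
    by rewrite get_upd // eqxx upd_upd e size_nseq addn1.
  have e3 : upd r j (nseq (2 * a + 0) true) = upd r j (nseq (2 * size (get r j)) true).
    by rewrite addn0 e size_nseq.
  case: s => [|[]|] /=; rewrite ?e2 ?e3; [exact: Exec_ret| |exact: Exec_ret|exact: Exec_ret].
  by apply: Exec_push; rewrite size_upd.
by rewrite e size_nseq; lia.
Qed.

Definition readpairs : pM unit :=
  loop (fun _ : unit => s <- read ;;
    if s is Bit true then s' <- read ;; double_add 8 s' ;;; ret (inl tt) else ret (inr tt)) tt.

Definition readbin : pM unit :=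
  loop (fun _ : unit => s <- read ;;
    if s is Bit b then double_add 9 (Bit b) ;;; ret (inl tt) else ret (inr tt)) tt.

(** A doubling is linear in the counter, and [(2 * acc + b).+1 <= 2 * acc.+1] keeps the counter
    below [2 ^ size w * acc.+1] throughout. *)
Lemma Exec_readpairs O w acc r y : 8 < size r -> get r 6 = [::] -> get r 8 = nseq acc true ->
  Exec O readpairs (Cfg r (enc w) y) tt
    (Cfg (upd r 8 (nseq (pairs acc w).1 true)) (enc (pairs acc w).2) y)
    (size w * (12 * (2 ^ size w * acc.+1) + 8) + 2).
Proof.
(* A round consumes two symbols, so the induction runs on a bound for the length. *)
have [m hm] := ubnP (size w); elim: m w hm acc r => // m IH [|[] w] /= hm acc r r8 e6 e8.
- rewrite -e8 upd_get; apply: Exec_loop_stop; apply: (@Exec_le _ _ _ _ _ _ (1 + 1)) => //.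
  by eapply Exec_bind; [exact: Exec_read|exact: Exec_ret].
- have r6 : 6 < size r by lia.
  have step t2 s2 : Exec O readpairs (Cfg (upd r 8 (nseq (2 * acc + head false w) true)) (enc (behead w)) y) tt s2 t2 ->
    Exec O readpairs (Cfg r (Bit true :: enc w) y) tt s2 (12 * acc + 8 + t2).
    move=> h; eapply Exec_le; first eapply Exec_loop_next; last 1 [exact: h|idtac].
      eapply Exec_bind; first exact: Exec_read.
      rewrite /=; eapply Exec_bind; first exact: Exec_read.
      eapply Exec_bind; first exact: (@Exec_double_add _ _ acc).
      have -> : bit_of (head Blank (enc w)) = head false w by case: (w).
      have -> : behead (enc w) = enc (behead w) by case: (w).
      exact: Exec_ret.
    lia.
  case: w hm step => [|b w] hm step.
    eapply Exec_le; first apply: step.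
      rewrite addn0 /=; have := IH [::] _ (2 * acc) (upd r 8 (nseq (2 * acc) true)).
      rewrite size_upd upd_upd !get_upd // => H; exact: H.
    rewrite /=; lia.
  eapply Exec_le; first apply: step.
    rewrite /=; have := IH w _ (2 * acc + b) (upd r 8 (nseq (2 * acc + b) true)).
    rewrite size_upd upd_upd !get_upd // => H; apply: H => //; rewrite /= in hm; lia.
  rewrite /= !expnS.
  have : (2 * acc + b).+1 <= 2 * acc.+1 by case: (b); lia.
  have : 0 < 2 ^ size w by rewrite expn_gt0.
  move: (size w) (2 ^ size w) => l z z0 hb.
  have h1 : z * (2 * acc + b).+1 <= 2 * (2 * z) * acc.+1.
    have -> : 2 * (2 * z) * acc.+1 = 2 * (z * (2 * acc.+1)) by lia.
    by apply: leq_trans (leq_pmull _ _); rewrite ?leq_mul.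
  have h2 : l * (12 * (z * (2 * acc + b).+1) + 8) <= l * (12 * (2 * (2 * z) * acc.+1) + 8).
    by rewrite leq_mul // leq_add2r leq_mul.
  have h3 : acc <= 2 * (2 * z) * acc.+1.
    by apply: leq_trans (leqnSn _) _; rewrite leq_pmull // !muln_gt0.
  move: h2 h3; move: (_ * acc.+1) (l * _) => u v h2 h3.
  lia.
- eapply Exec_le.
    apply: Exec_loop_stop; eapply Exec_bind; first exact: Exec_read.
    rewrite -e8 upd_get; exact: Exec_ret.
  lia.
Qed.

Lemma Exec_readbin O w acc r y : 9 < size r -> get r 6 = [::] -> get r 9 = nseq acc true ->
  Exec O readbin (Cfg r (enc w) y) tt
    (Cfg (upd r 9 (nseq (foldl (fun a (b : bool) => 2 * a + b) acc w) true)) [::] y)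
    (size w * (12 * (2 ^ size w * acc.+1) + 8) + 2).
Proof.
elim: w acc r => [|b w IH] acc r r9 e6 e9.
  rewrite /= -e9 upd_get; apply: Exec_loop_stop; apply: (@Exec_le _ _ _ _ _ _ (1 + 1)) => //.
  by eapply Exec_bind; [exact: Exec_read|exact: Exec_ret].
have r6 : 6 < size r by lia.
eapply Exec_le; first eapply Exec_loop_next.
    eapply Exec_bind; first exact: Exec_read.
    rewrite /=; eapply Exec_bind; first exact: (@Exec_double_add _ _ acc).
    exact: Exec_ret.
  have := IH (2 * acc + b) (upd r 9 (nseq (2 * acc + b) true)).
  rewrite size_upd upd_upd !get_upd // => H; exact: H.
rewrite /= !expnS.
have hb : (2 * acc + b).+1 <= 2 * acc.+1 by case: (b); lia.
have : 0 < 2 ^ size w by rewrite expn_gt0.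
move: (size w) (2 ^ size w) => l z z0.
have h1 : z * (2 * acc + b).+1 <= 2 * z * acc.+1.
  by rewrite [2 * z]mulnC -mulnA leq_mul.
have h2 : l * (12 * (z * (2 * acc + b).+1) + 8) <= l * (12 * (2 * z * acc.+1) + 8).
  by rewrite leq_mul // leq_add2r leq_mul.
have h3 : acc <= 2 * z * acc.+1.
  by apply: leq_trans (leqnSn _) _; rewrite leq_pmull // !muln_gt0.
move: h2 h3; move: (_ * acc.+1) (l * _) => u v h2 h3.
lia.
Qed.

Lemma unb_lt w acc : foldl (fun a (b : bool) => 2 * a + b) acc w < 2 ^ size w * acc.+1.
Proof.
elim: w acc => [|b w IH] acc /=; first by rewrite mul1n.
apply: leq_trans (IH _) _; rewrite expnSr -mulnA leq_mul2l; case: (b); lia.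
Qed.

Lemma pairs_lt w acc : (pairs acc w).1 < 2 ^ size w * acc.+1 /\ size (pairs acc w).2 <= size w.
Proof.
have [m hm] := ubnP (size w); elim: m w hm acc => // m IH [|[] [|b w]] /= hm acc.
- by split; lia.
- by split; rewrite ?expn1; lia.
- have hw : size w < m by lia.
  have [h1 h2] := IH w hw (2 * acc + b); split; last by lia.
  apply: leq_trans h1 _; rewrite !expnSr -!mulnA leq_mul2l; case: (b); lia.
- by split; rewrite ?expn1; lia.
- by split; rewrite // leq_pmull // expn_gt0.
Qed.

Lemma mk_rcons n u b : mk n (rcons u b) = rcons (mk n u) b.
Proof. by rewrite /mk rcons_cat. Qed.

(** Register 11 always holds the query [mk n u] for the prefix [u] found so far: each round tries a
    1 on top and replaces it by 0 after a negative answer. No choice bit is used, so this is a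
    deterministic oracle computation. *)
Definition bit_prog := boot 11 (
  readpairs ;;; readbin ;;; mv 8 11 ;;; push 11 false ;;; push 9 true ;;;
  forpop 9 (fun _ => push 11 true ;;; a <- ask ;;
     if a then ret tt else pop 11 ;;; push 11 false) ;;;
  o <- pop 11 ;; ret (Some (odflt false o))).

Lemma Exec_bit_loop n j m i y :
  Exec prefadv (forpop 9 (fun _ => push 11 true ;;; a <- ask ;;
     if a then ret tt else pop 11 ;;; push 11 false))
    (Cfg [:: [::]; [::]; [::]; [::]; [::]; [::]; [::]; [::]; [::]; nseq m true; [::]; rev (mk n (build n j))] i y) tt
    (Cfg [:: [::]; [::]; [::]; [::]; [::]; [::]; [::]; [::]; [::]; [::]; [::]; rev (mk n (build n (j + m)))] i y)
    (6 * m + 2).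
Proof.
elim: m j => [|m IH] j; first by rewrite addn0; exact: Exec_forpop_nil.
have := IH j.+1; rewrite addSnnS => h.
have hb : Exec prefadv
    (if prefadv (mk n (rcons (build n j) true)) then ret tt else pop 11 ;;; push 11 false)
    (Cfg [:: [::]; [::]; [::]; [::]; [::]; [::]; [::]; [::]; [::]; nseq m true; [::]; true :: rev (mk n (build n j))] i y) tt
    (Cfg [:: [::]; [::]; [::]; [::]; [::]; [::]; [::]; [::]; [::]; nseq m true; [::]; rev (mk n (build n j.+1))] i y) 2.
  rewrite [build n j.+1]/= [mk n (rcons _ (prefadv _))]mk_rcons rev_rcons.
  case: (prefadv _); first by apply: Exec_le (Exec_ret _ _ _) _.
  have -> : 2 = 1 + 1 by [].
  by xstep Exec_pop; exact: Exec_push.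
eapply Exec_le.
  eapply Exec_forpop_cons => //=.
    xstep Exec_push.
    eapply Exec_bind; first exact: Exec_ask.
    rewrite [last _ _]/= rev_cons revK -mk_rcons; exact: hb.
  exact: h.
lia.
Qed.

Lemma advbit_NE : NE_O prefadv advbit.
Proof.
pose t n := 11 + (2 * (n * (12 * 2 ^ n + 8)) + 10 * 2 ^ n + 30).
have [k' hk'] : exists k', forall n, 8 * t n * t n < expb k' n.
  by apply: eb_time; rewrite /t; ebnd.
have main w c : exists s', Exec prefadv bit_prog (Cfg [:: [::]] (enc w) c)
    (Some (advbit w)) s' (t (size w)).
  have [h1 h2] := pairs_lt w 0; have h3 := unb_lt (pairs 0 w).2 0.
  have := Exec_readbin prefadv (pairs 0 w).2 (acc := 0)
    (r := [:: [::]; [::]; [::]; [::]; [::]; [::]; [::]; [::]; nseq (pairs 0 w).1 true; [::]; [::]; [::]]) c isT erefl erefl.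
  rewrite /= -/(unb _) => hb.
  eexists; apply: Exec_boot; eapply Exec_le => /=.
    eapply Exec_bind; first exact: (@Exec_readpairs _ _ 0).
    rewrite /=; eapply Exec_bind; first exact: hb.
    xstep Exec_mv.
    rewrite cats0 rev_nseq.
    xstep Exec_push.
    xstep Exec_push.
    have hl := @Exec_bit_loop (pairs 0 w).1 0 (unb (pairs 0 w).2).+1 [::] c.
    rewrite {1}/mk rev_cat rev_cons rev_nseq /= in hl.
    eapply Exec_bind; first exact: hl.
    xstep Exec_pop.
    rewrite [in mk _ (rcons _ _)]mk_rcons rev_rcons /=.
    have -> : advbit w = last false (build (pairs 0 w).1 (unb (pairs 0 w).2).+1).
      by rewrite /advbit; case: (pairs 0 w).
    rewrite /= last_rcons; exact: Exec_ret.
  rewrite /= size_nseq !muln1 in h1 h3 *.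
  have h4 : 2 ^ size (pairs 0 w).2 <= 2 ^ size w by rewrite leq_exp2l.
  have : size (pairs 0 w).2 * (12 * 2 ^ size (pairs 0 w).2 + 8) <= size w * (12 * 2 ^ size w + 8).
    by rewrite leq_mul // leq_add2r leq_mul.
  rewrite -/(unb _) in h3 *; lia.
exists k'; apply: (@NTIME_intro _ _ bit_prog _ t) => // [w c|w hw].
  have [s' h] := main w c; eexists; exists s'; split; first exact: h.
  by case.
by have [s' h] := main w [::]; rewrite hw in h; exists [::], s'.
Qed.

(** * Polynomial time for [L] from an exponential-time machine for [advbit] *)

Definition wenc n i := flatten [seq [:: true; b] | b <- rev (bits n)] ++ false :: rev (bits i).

Lemma lval_bits n : lval (bits n) = n.
Proof.
elim/ltn_ind: n => n IH; rewrite bitsE /=; case: eqP => h /=; first by lia.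
rewrite IH; lia.
Qed.

Lemma unb_rev l : unb (rev l) = lval l.
Proof. by rewrite /unb foldl_rev /lval; elim: l => //= b l ->; rewrite addnC. Qed.

Lemma pairs_wenc acc l u :
  pairs acc (flatten [seq [:: true; b] | b <- l] ++ false :: u) =
  (foldl (fun a (b : bool) => 2 * a + b) acc l, u).
Proof. by elim: l acc => //= b l IH acc; rewrite IH. Qed.

Lemma advbit_wenc n i : advbit (wenc n i) = last false (build n i.+1).
Proof. by rewrite /advbit /wenc pairs_wenc -/(unb _) !unb_rev !lval_bits. Qed.

Lemma build_advbit n m : build n m = mkseq (fun i => advbit (wenc n i)) m.
Proof. by elim: m => //= m IH; rewrite mkseqS -IH advbit_wenc /= last_rcons. Qed.

Lemma size_wenc n i : size (wenc n i) = 2 * size (bits n) + (size (bits i)).+1.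
Proof.
rewrite /wenc size_cat /= size_rev; congr (_ + _).
by rewrite -(size_rev (bits n)); elim: (rev _) => //= b l ->; lia.
Qed.

Section Final.
Variables (kE : nat) (ME : TM).
Hypothesis hME : forall w, result ME no_oracle det_choices (enc w) (expb kE (size w)) = Some (Some (advbit w)).

(** The code of the pair is written back to front onto the simulated tape, because pushing prepends:
    first the digits of [i], then the separating 0, then the digits of [n], each below its marker 1.
    Registers 0 and 2, empty between simulations, serve as scratch space. *)
Definition fetch : pM unit :=
  addu 9 10 11 ;;; tobin 10 0 11 2 ;;; forpop 11 (fun b => pushsym 1 (Bit b)) ;;;
  pushsym 1 (Bit false) ;;;
  addu 8 10 11 ;;; tobin 10 0 11 2 ;;;
  forpop 11 (fun b => pushsym 1 (Bit b) ;;; pushsym 1 (Bit true)) ;;;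
  o <- simc ME ;; push 6 (o == Some true) ;;; push 9 true.

Definition adv_prog := boot 11 (
  readx 5 ;;; addu 5 8 6 ;;; pevalp p 8 7 9 10 ;;; forpop 7 (fun _ => fetch) ;;; simxy A).

Definition fcost n i := 47 * (n + i) + 120 + 14 * (size (bits n) + size (bits i)) + 40 * expb kE (size (wenc n i))
  + 6 * size (wenc n i).

Lemma Exec_fetch O x y6 r7 n i inp c :
  Exec O fetch
    (Cfg [:: [::]; [::]; [::]; [::]; [::]; x; y6; r7; nseq n true; nseq i true; [::]; [::]] inp c) tt
    (Cfg [:: [::]; [::]; [::]; [::]; [::]; x; advbit (wenc n i) :: y6; r7; nseq n true; nseq i.+1 true; [::]; [::]] inp c)
    (fcost n i).
Proof.
set R := fun w l => [:: [::]; encs w; [::]; [::]; [::]; x; y6; r7; nseq n true; nseq i true; [::]; l].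
have aux1 l : forall w, Exec O (forpop 11 (fun b => pushsym 1 (Bit b))) (Cfg (R w l) inp c) tt
    (Cfg (R (map Bit (rev l) ++ w) [::]) inp c) (4 * size l + 2).
  elim: l => [|b l IH] w; first exact: Exec_forpop_nil.
  eapply Exec_le.
    eapply Exec_forpop_cons => //=; first exact: Exec_pushsym.
    rewrite /=; have := IH (Bit b :: w); rewrite rev_cons map_rcons cat_rcons; exact.
  by rewrite /=; lia.
have aux2 l : forall w, Exec O (forpop 11 (fun b => pushsym 1 (Bit b) ;;; pushsym 1 (Bit true))) (Cfg (R w l) inp c) tt
    (Cfg (R (map Bit (flatten [seq [:: true; b] | b <- rev l]) ++ w) [::]) inp c) (6 * size l + 2).
  elim: l => [|b l IH] w; first exact: Exec_forpop_nil.
  eapply Exec_le.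
    eapply Exec_forpop_cons => //=.
      eapply Exec_bind; first exact: Exec_pushsym.
      exact: Exec_pushsym.
    rewrite /=; have := IH [:: Bit true, Bit b & w].
    by rewrite rev_cons map_rcons flatten_rcons map_cat -catA; exact.
  by rewrite /=; lia.
eapply Exec_le.
  xstep Exec_addu.
  rewrite size_nseq cats0.
  xstep Exec_tobin.
  rewrite size_nseq.
  eapply Exec_bind; first exact: (aux1 _ [::]).
  rewrite cats0.
  xstep Exec_pushsym.
  xstep Exec_addu.
  rewrite size_nseq cats0.
  xstep Exec_tobin.
  rewrite size_nseq.
  eapply Exec_bind; first exact: (aux2 _ (Bit false :: map Bit (rev (bits i)))).
  have -> : map Bit (flatten [seq [:: true; b] | b <- rev (bits n)]) ++ Bit false :: map Bit (rev (bits i))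
     = enc (wenc n i) by rewrite /wenc /enc map_cat.
  rewrite /R; eapply Exec_bind.
    by have h := hME (wenc n i); rewrite det_nil in h; exact: Exec_simc h.
  have -> : (Some (advbit (wenc n i)) == Some true) = advbit (wenc n i) by case: (advbit _).
  xstep Exec_push.
  exact: Exec_push.
rewrite /= !size_nseq size_map /fcost; lia.
Qed.
End Final.

(** [2 ^ size (bits i)] is at most [2 * i + 2]. The code spends two symbols on each digit of [n],
    one on each digit of [i] and one on the separator, whence the square and the factor 2;
    exponential time on the code is polynomial in [n] and [m]. *)
Definition fbound kE n m := 47 * (n + m) + 14 * (2 * n + 2 + (2 * m + 2)) + 120 +
  40 * (((2 * n + 2) ^ 2 * (2 * m + 2) * 2) ^ kE * 2 ^ kE) + 6 * (2 * (2 * n + 2) + (2 * m + 3)).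

Lemma fcost_le kE n i m : i <= m -> fcost kE n i <= fbound kE n m.
Proof.
move=> im.
have sn : size (bits n) <= 2 * n + 2.
  by apply: leq_trans (exp_size_bits n); apply: ltnW; apply: ltn_expl.
have si : size (bits i) <= 2 * m + 2.
  by apply: leq_trans (ltnW (ltn_expl _ (leqnn 2))) (leq_trans (exp_size_bits i) _); lia.
have he : expb kE (size (wenc n i)) <= ((2 * n + 2) ^ 2 * (2 * m + 2) * 2) ^ kE * 2 ^ kE.
  rewrite /expb expnD leq_mul2r mulnC expnM; apply/orP; right.
  have : 2 ^ size (wenc n i) <= (2 * n + 2) ^ 2 * (2 * m + 2) * 2.
    rewrite size_wenc expnD expnSr mulnA [2 * size _]mulnC expnM leq_mul2r /=.
    rewrite leq_mul //; last by apply: leq_trans (exp_size_bits i) _; lia.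
    by rewrite leq_exp2r // exp_size_bits.
  by case: (kE) => // kE'; rewrite leq_exp2r.
rewrite /fcost /fbound; move: he; rewrite size_wenc; lia.
Qed.

Lemma E_advbit_P : E advbit -> P L.
Proof.
case=> kE [ME hME].
pose t n := 11 + (10 * n + 6 + pcost p n + (peval p n * (fbound kE n (peval p n) + 2) + 2) +
   (40 * polyb k n + 14 * n + 14 * peval p n + 30)).
have hp := pb_pcost p.
have [k' hk'] : exists k', forall n, 8 * t n * t n < polyb k' n.
  by apply: pb_time; rewrite /t /fbound; pbnd.
exists k', (toTM (adv_prog ME)) => x; rewrite result_det.
set n := size x; set F := fun i => advbit (wenc n i).
have loop m : forall i, i + m <= peval p n ->
  Exec no_oracle (forpop 7 (fun _ => fetch ME))
    (Cfg [:: [::]; [::]; [::]; [::]; [::]; rev x; rev (mkseq F i); nseq m true; nseq n true; nseq i true; [::]; [::]] [::] [::]) tt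
    (Cfg [:: [::]; [::]; [::]; [::]; [::]; rev x; rev (mkseq F (i + m)); [::]; nseq n true; nseq (i + m) true; [::]; [::]] [::] [::])
    (m * (fbound kE n (peval p n) + 2) + 2).
  elim: m => [|m IH] i hi; first by rewrite addn0; exact: Exec_forpop_nil.
  eapply Exec_le.
    eapply Exec_forpop_cons => //=.
      exact: Exec_fetch hME _ _ _ _ _ _ _ _.
    have := IH i.+1; rewrite addSnnS mkseqS rev_rcons => /(_ hi) h; exact: h.
  have := @fcost_le kE n i (peval p n); lia.
have hL := build_good (erefl (size x)); rewrite build_advbit -/n -/F in hL.
apply: resultL_Exec (hk' n).
apply: Exec_boot; eapply Exec_le => /=.
  eapply Exec_bind; first by rewrite -[enc x]cats0; exact: Exec_readx.
  rewrite /= cats0.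
  xstep Exec_addu.
  rewrite size_rev cats0 -/n.
  xstep Exec_pevalp.
  rewrite size_nseq.
  eapply Exec_bind; first exact: (loop _ 0 _).
  rewrite add0n; exact: Exec_simxy hL.
rewrite size_mkseq /= size_nseq size_rev -/n; lia.
Qed.
End IV.

Lemma E_NE_NP_NP_P_YP : (forall L, E L <-> NE_NP_NP L) -> forall L, P L <-> YP L.
Proof.
move=> hE L; split=> [|[p [k [A [good sound]]]]]; first exact: P_YP.
apply: (E_advbit_P good sound); apply/hE.
exists (prefadv p k A); split; last exact: advbit_NE.
exists (badadv k A); split; [exact: badadv_NP sound|exact: prefadv_NP].
Qed.

Theorem theorem16 :
  (forall L : lang, ZPP L -> YP L) /\
  (forall L : lang, YE L <-> NE L /\ coNE L) /\
  ((forall L : lang, P L <-> YP L) -> forall L : lang, E L <-> NE L /\ coNE L) /\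
  ((forall L : lang, E L <-> NE_NP_NP L) -> forall L : lang, P L <-> YP L).
Proof.
split; first exact: ZPP_YP.
split; first by move=> L; split=> [/YE_NE_coNE //|[h1 h2]]; exact: NE_coNE_YE.
split; last exact: E_NE_NP_NP_P_YP.
move=> hP L; split=> [|[h1 h2]]; first exact: E_NE_coNE.
by apply: padded_P_E; apply/hP; apply: padded_YP.
Qed.
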